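(* Let $R$ be the endomorphism ring of an elliptic curve, let $H$ be a finite subgroup of $GL(2,R)$ with $$H\cap SL(2,R)=\langle g\rangle\simeq C_4,$$ and let $h_o\in H$ be an element of order $r$ with $\det(H)=\langle\det(h_o)\rangle\simeq C_s$, $s>1$, and eigenvalues $\lambda_1(h_o),\lambda_2(h_o)$. Then $H$ is isomorphic to some $H_{C4}(i)$, $1\leq i\leq9$, where $H_{C4}(1)=\langle h_o\rangle\simeq C_8$ with $R=\mathcal{O}_{-2}$, $\lambda_1(h_o)=e^{\frac{\pi i}{4}}$, $\lambda_2(h_o)=e^{\frac{3\pi i}{4}}$; $H_{C4}(2)=\langle g\rangle\times\langle h_o\rangle\simeq C_4\times C_2$ with $R=R_{-1,f}$, $\lambda_1(h_o)=-1$, $\lambda_2(h_o)=1$; $H_{C4}(3)=\langle g,h_o\mid g^2=-I_2,\ h_o^2=I_2,\ h_ogh_o^{-1}=g^{-1}\rangle\simeq\mathcal{D}_4$ is the dihedral group of order $8$ with $\lambda_1(h_o)=-1$, $\lambda_2(h_o)=1$; $H_{C4}(4)=\langle h_o\rangle\simeq C_{12}$ with $R=\mathcal{O}_{-3}$, $\lambda_1(h_o)=e^{\frac{5\pi i}{6}}$, $\lambda_2(h_o)=e^{-\frac{\pi i}{6}}$; $H_{C4}(5)=\langle g\rangle\times\langle e^{\frac{2\pi i}{3}}I_2\rangle\simeq C_4\times C_3$ for $R=\mathcal{O}_{-3}$ and any $g\in SL(2,\mathcal{O}_{-3})$ with $\mathrm{tr}(g)=0$; $H_{C4}(6)=\langle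 g\rangle\times\langle h_o\rangle\simeq C_4\times C_4$ with $R=\mathbb{Z}[i]$, $\lambda_1(h_o)=i$, $\lambda_2(h_o)=1$; $H_{C4}(7)=\langle ig\rangle\times\langle h_o\rangle\simeq C_2\times C_8$ with $R=\mathbb{Z}[i]$, $\lambda_1(h_o)=e^{\frac{3\pi i}{4}}$, $\lambda_2(h_o)=e^{-\frac{\pi i}{4}}$; $H_{C4}(8)=\langle g,h_o\mid g^2=h_o^4=-I_2,\ h_ogh_o^{-1}=g^{-1}\rangle$ of order $16$ with $R=\mathbb{Z}[i]$, $\lambda_1(h_o)=e^{\frac{3\pi i}{4}}$, $\lambda_2(h_o)=e^{-\frac{\pi i}{4}}$; $H_{C4}(9)=\langle g,h_o\mid g^2=-I_2,\ h_o^6=I_2,\ h_ogh_o^{-1}=g^{-1}\rangle$ of order $24$ with $R=\mathcal{O}_{-3}$, $\lambda_1(h_o)=e^{\frac{2\pi i}{3}}$, $\lambda_2(h_o)=e^{-\frac{\pi i}{3}}$. There exist subgroups $H_{C4}(1)<GL(2,\mathcal{O}_{-2})$, $H_{C4}(4),H_{C4}(5)<GL(2,\mathcal{O}_{-3})$, $H_{C4}(2),H_{C4}(6)<GL(2,\mathbb{Z}[i])$, as well as subgroups $H^o_{C4}(7),H^o_{C4}(8)<GL(2,\mathbb{Q}(\sqrt2,i))$, $H^o_{C4}(3)<GL(2,\mathbb{Q}(\sqrt{-d}))$, $H^o_{C4}(9)<GL(2,\mathbb{Q}(\sqrt{-3}))$ with $H^o_{C4}(j)\simeq H_{C4}(j)$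 for $j\in\{3,7,8,9\}$.
   Context: $R=\mathrm{End}(E)$ for a complex elliptic curve $E$; thus $R=\mathbb{Z}$ or $R=R_{-d,f}=\mathbb{Z}+f\mathcal{O}_{-d}\subset\mathbb{C}$ with a conductor $f\in\mathbb{N}$ and $\mathcal{O}_{-d}$ the integers ring of an imaginary quadratic field $\mathbb{Q}(\sqrt{-d})$; in all cases $R\subset\mathbb{Q}(\sqrt{-d})$ (for $R=\mathbb{Z}$, with any $d\in\mathbb{N}$). $GL(2,R)=\{g\in R_{2\times2}:\det(g)\in R^*\}$, $SL(2,R)$ is its subgroup of matrices of determinant $1$, and $C_n$ is the cyclic group of order $n$. In the list, $g$ denotes an element of order $4$ of $SL(2,R)$ (equivalently, of trace $0$, and then $g^2=-I_2$) and $h_o$ an element of $GL(2,R)$ of finite order with the indicated eigenvalues; ''with $R=\dots$'' means that the case is listed only for that ring. *)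

(* Defs.v *)
From HB Require Import structures.
From mathcomp Require Import all_boot all_order all_algebra all_fingroup all_solvable.
From mathcomp Require Import complex.
From mathcomp Require Import boolp classical_sets functions cardinality reals trigo.

Set Implicit Arguments.
Unset Strict Implicit.
Unset Printing Implicit Defensive.

Import Order.TTheory GRing.Theory Num.Theory.

Local Open Scope classical_set_scope.
Local Open Scope ring_scope.
Local Open Scope complex_scope.

(* MathComp groups are finite; a possibly infinite multiplicative group such as
   GL(2, R) or C^* is handled as a set of units of a ring A, which is 'M[C]_2
   or C below. *)
Section UnitSubgroups.
Variable A : unitRingType.
Implicit Types (H K : set A) (x : A).

Definition is_subgroup H :=
  H `<=` [set x | x \is a GRing.unit] /\ divr_closed [in H].

Definition gen (S : set A) : set A := smallest is_subgroup S.

Definition cycle_of x : set A := gen [set x].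

Definition has_card H (n : nat) := (H #= `I_n)%card.

Definition has_order x (n : nat) := has_card (cycle_of x) n.

Definition internal_dprod H1 H2 K :=
  [/\ K = [set x * y | x in H1 & y in H2],
      H1 `&` H2 = [set 1] &
      {in H1 & H2, forall x y, x * y = y * x}].

Definition isom_fin (gT : finGroupType) (G : {group gT}) H :=
  exists2 f : gT -> A,
    set_bij [set` G] H f & {in G &, forall a b : gT, f (a * b)%g = f a * f b}.

End UnitSubgroups.

Definition isom_sub (A B : unitRingType) (H : set A) (K : set B) :=
  exists2 f : A -> B, set_bij H K f & {in H &, {morph f : x y / x * y}}.

Section EndomorphismRings.
Variable K : realType.
Local Notation C := K[i].

Definition expi (t : K) : C := cos t +i* sin t.

Definition lattice (w1 w2 : C) : set C :=
  [set z | exists m n : int, z = m%:~R * w1 + n%:~R * w2].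

Definition real_indep (w1 w2 : C) :=
  forall a b : K, a%:C * w1 + b%:C * w2 = 0 -> a = 0 /\ b = 0.

(* For E = C/L, the ring End(E) is identified, through its action on the
   universal cover C, with the set of all a in C such that a L is contained
   in L. *)
Definition is_elliptic_End (R : set C) :=
  exists w1 w2 : C, real_indep w1 w2 /\
    R = [set a | forall z, lattice w1 w2 z -> lattice w1 w2 (a * z)].

Definition field_gen (S : set C) : set C :=
  smallest (fun F : set C => divring_closed [in F]) S.

Definition Qsqrt_opp (d : nat) : set C :=
  field_gen [set 0 +i* Num.sqrt (d%:R : K)].

Definition Qsqrt2_i : set C := field_gen [set (Num.sqrt (2%:R : K))%:C; 'i].

Definition O_opp (d : nat) : set C :=
  [set z | Qsqrt_opp d z /\ integralOver (intr : int -> C) z].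

(* Z + f O_{-d}, for a conductor f > 0. *)
Definition R_opp (d f : nat) : set C :=
  [set z | exists (a : int) (w : C), O_opp d w /\ z = a%:~R + f%:R * w].

Definition Zi : set C := [set z | exists a b : int, z = a%:~R + b%:~R * 'i].

Definition GL2 (R : set C) : set 'M[C]_2 :=
  [set g : 'M[C]_2 | (forall i j, R (g i j)) /\ exists2 u, R u & \det g * u = 1].

Definition SL2 (R : set C) : set 'M[C]_2 :=
  [set g : 'M[C]_2 | GL2 R g /\ \det g = 1].

Definition eigenvalues (h : 'M[C]_2) (l1 l2 : C) :=
  char_poly h = ('X - l1%:P) * ('X - l2%:P).

End EndomorphismRings.

Arguments Qsqrt_opp : clear implicits.
Arguments Qsqrt2_i : clear implicits.
Arguments O_opp : clear implicits.
Arguments R_opp : clear implicits.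
Arguments Zi : clear implicits.

Section List.
Variable K : realType.
Local Notation C := K[i].
Implicit Types (R : set C) (g h : 'M[C]_2) (H : set 'M[C]_2).

(* The abstract group underlying H_C4(i).  In the presentations -I_2 is the
   square of g, so that g^2 = -I_2 amounts to g^4 = 1, and h^4 = -I_2 to
   h^4 = g^2. *)
Definition HC4_type (i : nat) H : Prop :=
  match i with
  | 1 => isom_fin (Zp 8) H
  | 2 => isom_fin (finset.setX (Zp 4) (Zp 2)) H
  | 3 => isom_fin [set: gsort (dihedral_gtype 8)]%G H /\
         exists (gT : finGroupType) (G : {group gT}), isom_fin G H /\
           (G \isog Grp (g : h : g ^+ 4, h ^+ 2, h * g * h^-1 = g^-1))%g
  | 4 => isom_fin (Zp 12) H
  | 5 => isom_fin (finset.setX (Zp 4) (Zp 3)) H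
  | 6 => isom_fin (finset.setX (Zp 4) (Zp 4)) H
  | 7 => isom_fin (finset.setX (Zp 2) (Zp 8)) H
  | 8 => has_card H 16 /\
         exists (gT : finGroupType) (G : {group gT}), isom_fin G H /\
           (G \isog Grp (g : h : g ^+ 4, h ^+ 4 = g ^+ 2, h * g * h^-1 = g^-1))%g
  | 9 => has_card H 24 /\
         exists (gT : finGroupType) (G : {group gT}), isom_fin G H /\
           (G \isog Grp (g : h : g ^+ 4, h ^+ 6, h * g * h^-1 = g^-1))%g
  | _ => False
  end.

Definition g_elt R g := SL2 R g /\ has_order g 4.

Definition h_elt R h (l1 l2 : C) :=
  [/\ GL2 R h, finite_set (cycle_of h) & eigenvalues h l1 l2].

Definition HC4_5_of g H :=
  internal_dprod (cycle_of g) (cycle_of (expi (2 * pi / 3))%:M) H.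

Definition HC4_gens (i : nat) R H : Prop :=
  match i with
  | 1 => R = O_opp K 2 /\
      exists2 h, h_elt R h (expi (pi / 4)) (expi (3 * pi / 4)) & H = cycle_of h
  | 2 => (exists2 f : nat, (0 < f)%N & R = R_opp K 1 f) /\
      exists g h, [/\ g_elt R g, h_elt R h (-1) 1 &
        internal_dprod (cycle_of g) (cycle_of h) H]
  | 3 =>
      exists g h, [/\ g_elt R g, h_elt R h (-1) 1, H = gen [set g; h] &
        [/\ g ^+ 2 = - 1, h ^+ 2 = 1 & h * g * h^-1 = g^-1]]
  | 4 => R = O_opp K 3 /\
      exists2 h, h_elt R h (expi (5 * pi / 6)) (expi (- (pi / 6))) &
        H = cycle_of h
  | 5 => R = O_opp K 3 /\
      exists g, [/\ SL2 R g, \tr g = 0 & HC4_5_of g H]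
  | 6 => R = Zi K /\
      exists g h, [/\ g_elt R g, h_elt R h 'i 1 &
        internal_dprod (cycle_of g) (cycle_of h) H]
  | 7 => R = Zi K /\
      exists g h, [/\ g_elt R g,
        h_elt R h (expi (3 * pi / 4)) (expi (- (pi / 4))) &
        internal_dprod (cycle_of ('i%:M * g)) (cycle_of h) H]
  | 8 => R = Zi K /\
      exists g h, [/\ g_elt R g,
        h_elt R h (expi (3 * pi / 4)) (expi (- (pi / 4))), H = gen [set g; h] &
        [/\ g ^+ 2 = - 1, h ^+ 4 = - 1 & h * g * h^-1 = g^-1]]
  | 9 => R = O_opp K 3 /\
      exists g h, [/\ g_elt R g,
        h_elt R h (expi (2 * pi / 3)) (expi (- (pi / 3))), H = gen [set g; h] &
        [/\ g ^+ 2 = - 1, h ^+ 6 = 1 & h * g * h^-1 = g^-1]]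
  | _ => False
  end.

Definition HC4 (i : nat) R H :=
  [/\ is_subgroup H, H `<=` GL2 R, HC4_gens i R H & HC4_type i H].

(* A subgroup of GL(2, F) which is only required to be isomorphic to H_C4(i):
   the isomorphism type of H_C4(i) does not depend on R, g and h. *)
Definition HC4o (i : nat) (F : set C) H :=
  [/\ is_subgroup H, H `<=` GL2 F & HC4_type i H].

End List.

(* Main.v *)
Require Import Defs.
From HB Require Import structures.
From mathcomp Require Import all_boot all_order all_algebra all_fingroup all_solvable.
From mathcomp Require Import all_field.
From mathcomp Require Import complex ring lra zify.
From mathcomp Require Import boolp classical_sets functions cardinality reals trigo.

Set Implicit Arguments.
Unset Strict Implicit.
Unset Printing Implicit Defensive.

Import Order.TTheory GRing.Theory Num.Theory.

Local Open Scope classical_set_scope.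
Local Open Scope ring_scope.
Local Open Scope complex_scope.

(** Let g be the given element of order 4 and put eps = det(ho), a root of unity
of order s in R. Then g^2 = -1, and H is the set of the products g^a ho^b
(prodsE), since x ho^-b has determinant 1 as soon as det(x) = eps^b. So H is
determined by s, by ho^s, which lies in the group generated by g, and by the
action of ho on this group, which is trivial or the inversion
(conj_dichotomy).

The arithmetic input is that the lattice of the curve has rank 2. Every element
of R is a root of a monic integer quadratic polynomial, the real elements of R
are integers, and R lies in the field generated by any of its non-real
elements. Hence a root of unity in R has order 1, 2, 3, 4 or 6
(elliptic_root_of_unity), so that s is 2, 3, 4 or 6; R is Z[i], O_-2 or O_-3
as soon as it contains i, sqrt(-2) or a primitive cube root of unity; and no
two of these are contained in the same R, because the products of the square
roots of -1, -2 and -3 have squares 2, 3 and 6, which are not squares of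
integers (elliptic_sqr_mul).

The group-theoretic input is the Cayley-Hamilton theorem: a 2 x 2 matrix whose
square is a scalar either is a scalar or has trace 0 (scalar_or_tr0).

- If ho commutes with g, the main tool is commuting_sqr: an element of
  determinant -1 commuting with g whose square is a power of g forces i or
  sqrt(-2) to lie in R. For s = 2 this leads to HC4 2 and HC4 1. For s = 3
  some g^k ho has order 3, and H is isomorphic to a group of HC4 5. For s = 4
  only ho^4 = 1 survives, and H is isomorphic to a group of HC4 6. The case
  s = 6 is impossible. The groups of HC4 4 and HC4 5 are isomorphic, and no H
  leads to HC4 7.
- If ho inverts g, then ho has trace 0 and ho^2 = -eps (inverting_tr0). This
  excludes s = 3 and leads to HC4 3, HC4 8 and HC4 9 for s = 2, 4 and 6, with H
  itself satisfying the conditions, after replacing ho by its inverse when eps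
  is the conjugate of the prescribed determinant.

The abelian groups are recognised as direct products of cyclic groups, the
determinant showing that the intersection is trivial. For a group presented by
g^4 = 1, h^s = g^k and h g h^-1 = g^-1, the relations bound the order by 4s;
the group of matrices reaches this bound, and a subdirect product argument
turns this into the universal property of the presentation
(isog_Grp_inverting). *)

(** * Subgroups of the units of a ring *)

Section UnitSubgroups.
Variable A : unitRingType.
Implicit Types (H : set A) (x y g h : A).

Lemma subgroup_intro H :
    (forall x, H x -> x \is a GRing.unit) -> H 1 ->
    (forall x y, H x -> H y -> H (x * y)) -> (forall x, H x -> H x^-1) ->
  is_subgroup H.
Proof.
move=> HU H1 HM HV; split=> //; split; first by rewrite mem_set.
by move=> x y /set_mem Hx /set_mem Hy; apply/mem_set/HM/HV.
Qed.

Lemma subgroup_unit H x : is_subgroup H -> H x -> x \is a GRing.unit.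
Proof. by case=> + _; apply. Qed.

Lemma subgroup1 H : is_subgroup H -> H 1.
Proof. by case=> _ [/set_mem]. Qed.

Lemma subgroupV H x : is_subgroup H -> H x -> H x^-1.
Proof.
move=> sH Hx; have [_ [H1 Hd]] := sH; rewrite -[x^-1]mul1r.
by apply/set_mem/Hd => //; apply/mem_set.
Qed.

Lemma subgroupM H x y : is_subgroup H -> H x -> H y -> H (x * y).
Proof.
move=> sH Hx Hy; have [_ [_ Hd]] := sH; rewrite -[y]invrK.
by apply/set_mem/Hd; apply/mem_set => //; apply: subgroupV.
Qed.

Lemma subgroupX H x n : is_subgroup H -> H x -> H (x ^+ n).
Proof.
move=> sH Hx; elim: n => [|n IHn]; first exact: subgroup1.
by rewrite exprS; apply: subgroupM.
Qed.

Lemma subgroup_gen (S : set A) :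
  (forall x, S x -> x \is a GRing.unit) -> is_subgroup (gen S).
Proof.
move=> SU; apply: subgroup_intro.
- move=> x /(_ [set u | u \is a GRing.unit]); apply; split => //.
  apply: subgroup_intro => //= [|a b ua ub|a ua]; first exact: unitr1.
    by rewrite unitrMl.
  by rewrite unitrV.
- by move=> H [sH _]; apply: subgroup1.
- by move=> x y Sx Sy H [sH SH]; apply: subgroupM => //; [apply: Sx|apply: Sy].
- by move=> x Sx H [sH SH]; apply: subgroupV => //; apply: Sx.
Qed.

End UnitSubgroups.

Section CyclicSubgroups.
Variable A : unitRingType.
Implicit Types (H : set A) (x y g h : A).

Lemma prim_root_unit n x : n.-primitive_root x -> x \is a GRing.unit.
Proof.
move=> px; have n0 := prim_order_gt0 px.
have: x ^+ n \is a GRing.unit by rewrite (prim_expr_order px) unitr1.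
by rewrite unitrX_pos.
Qed.

Lemma prim_root_invE n x : n.-primitive_root x -> x^-1 = x ^+ n.-1.
Proof.
move=> px; have xU := prim_root_unit px.
apply: (mulIr xU); rewrite mulVr // -exprSr prednK ?(prim_order_gt0 px) //.
by rewrite (prim_expr_order px).
Qed.

Lemma subgroup_cycle x : x \is a GRing.unit -> is_subgroup (cycle_of x).
Proof. by move=> xU; apply: subgroup_gen => y ->. Qed.

Lemma cycle_of_id x : cycle_of x x.
Proof. by move=> H [_ sxH]; apply: sxH. Qed.

Arguments cycle_of_id : clear implicits.

Lemma cycle_ofX x k : x \is a GRing.unit -> cycle_of x (x ^+ k).
Proof.
by move=> xU; exact (subgroupX k (subgroup_cycle xU) (cycle_of_id x)).
Qed.

Lemma cycle_of_sub H x : is_subgroup H -> H x -> cycle_of x `<=` H.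
Proof. by move=> sH Hx y; apply; split=> // z ->. Qed.

Lemma cycle_ofE n x : n.-primitive_root x ->
  cycle_of x = [set y | exists2 k : nat, (k < n)%N & y = x ^+ k].
Proof.
move=> px; have xU := prim_root_unit px; have n0 := prim_order_gt0 px.
apply/seteqP; split=> [|y [k _ ->]]; last exact: cycle_ofX.
have powE k : exists2 j : nat, (j < n)%N & x ^+ k = x ^+ j.
  by exists (k %% n)%N; rewrite ?ltn_mod // (prim_expr_mod px).
apply: cycle_of_sub; last by have := powE 1%N; rewrite expr1.
apply: subgroup_intro => [_ [k _ ->]||_ _ [k _ ->] [j _ ->]|_ [k _ ->]].
- by rewrite unitrX.
- exact: (powE 0%N).
- by rewrite /= -exprD; apply: powE.
- by rewrite /= -exprVn (prim_root_invE px) -exprM; apply: powE.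
Qed.

Lemma cycle_of_inv n x : n.-primitive_root x -> cycle_of x^-1 = cycle_of x.
Proof.
move=> px; have xU := prim_root_unit px.
apply/seteqP; split; apply: cycle_of_sub.
- exact: subgroup_cycle.
- exact (subgroupV (subgroup_cycle xU) (cycle_of_id x)).
- by apply: subgroup_cycle; rewrite unitrV.
- have sV : is_subgroup (cycle_of x^-1) by apply: subgroup_cycle; rewrite unitrV.
  by rewrite -[X in _ X]invrK; exact (subgroupV sV (cycle_of_id _)).
Qed.

Lemma finite_cycle_of n x : n.-primitive_root x -> finite_set (cycle_of x).
Proof.
move=> px; rewrite (cycle_ofE px).
apply: (sub_finite_set (B := (fun k => x ^+ k) @` `I_n)).
  by move=> _ [k kn ->]; exists k.
exact/finite_image/finite_II.
Qed.

Lemma has_order_prim n x : n.-primitive_root x -> has_order x n.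
Proof.
move=> px; rewrite /has_order /has_card.
have -> : cycle_of x = (fun k => x ^+ k) @` `I_n.
  rewrite (cycle_ofE px); apply/seteqP.
  by split=> [_ [k kn ->]|_ [k kn <-]]; exists k.
apply: inj_card_eq => i j /set_mem /= lin /set_mem /= ljn /eqP.
by rewrite (eq_prim_root_expr px) !modn_small // => /eqP.
Qed.

Lemma isom_fin_cycle n x : (1 < n)%N -> n.-primitive_root x ->
  isom_fin (Zp n) (cycle_of x).
Proof.
case: n => [|[|n]] // _ px.
exists (fun a : 'Z_n.+2 => x ^+ (a : nat)).
  rewrite (cycle_ofE px); split=> [a _||_ [k kn ->]].
  - by exists (a : nat) => //; apply: ltn_ord.
  - move=> a b _ _ /eqP; rewrite (eq_prim_root_expr px).
    by rewrite !modn_small ?ltn_ord // => /eqP /val_inj.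
  - exists (inZp k : 'Z_n.+2); last by rewrite /= modn_small.
    by rewrite /= /Zp inE.
by move=> a b _ _; rewrite -exprD -(prim_expr_mod px (a + b)).
Qed.

(** The isomorphism is only assumed to preserve products; its value at the
neutral element is 1 because it is an invertible idempotent. *)
Lemma isom_fin1 (gT : finGroupType) (G : {group gT}) H (f : gT -> A) :
    is_subgroup H -> set_bij [set` G] H f ->
    {in G &, forall a b : gT, f (a * b)%g = f a * f b} ->
  f 1%g = 1.
Proof.
move=> sH [fH _ _] fM; have f1U : f 1%g \is a GRing.unit.
  by apply: (subgroup_unit sH); apply: fH; rewrite /= group1.
by apply: (mulIr f1U); rewrite -fM ?group1 // mulg1 mul1r.
Qed.

Lemma isom_fin_prim_root n x : (1 < n)%N -> is_subgroup (cycle_of x) ->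
  isom_fin (Zp n) (cycle_of x) -> n.-primitive_root x.
Proof.
move=> n1 sx [f fB fM]; have f1 := isom_fin1 sx fB fM.
have [fS fI fs] := fB; have n0 : (0 < n)%N by apply: ltnW.
have fX a k : a \in Zp n -> f (a ^+ k)%g = f a ^+ k.
  move=> Za; elim: k => [|k IHk]; first by rewrite expg0 f1.
  by rewrite expgS exprS fM ?groupX // IHk.
have [a Za fa] := fs x (cycle_of_id x).
have xn : x ^+ n = 1.
  rewrite -fa -fX // -[X in (a ^+ X)%g](card_Zp n0).
  by rewrite expg_cardG // f1.
have [m pm mn] := prim_order_exists n0 xn.
suff nm : (n %| m)%N by have /eqP-> : n == m by rewrite eqn_dvd nm mn.
have Z1 : (Zp1 : 'Z_n) \in Zp n by rewrite /Zp n1 inE.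
have [j _ fj] : exists2 j : nat, (j < m)%N & f Zp1 = x ^+ j.
  by have := fS _ Z1; rewrite (cycle_ofE pm).
have : (Zp1 ^+ m)%g = 1%g :> 'Z_n.
  apply: fI; rewrite ?mem_set //= ?groupX ?group1 //.
  by rewrite fX // fj exprAC (prim_expr_order pm) expr1n f1.
by move/eqP; rewrite -order_dvdn order_Zp1 Zp_cast.
Qed.

(** The order of x divides n; were it a proper divisor, it would divide n / p for
some prime p. *)
Lemma prim_root_primes (B : nzRingType) n (x : B) : (0 < n)%N -> x ^+ n = 1 ->
  all (fun p => x ^+ (n %/ p) != 1) (primes n) -> n.-primitive_root x.
Proof.
move=> n0 xn /allP np; have [m pm mn] := prim_order_exists n0 xn.
have [nm|nm] := leqP (n %/ m) 1.
  have mE := divnK mn; have m0 := prim_order_gt0 pm.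
  suff -> : n = m by [].
  case: (n %/ m)%N nm mE => [|[|//]] _; last by rewrite mul1n.
  by rewrite mul0n => n0'; rewrite -n0' in n0.
have pp := pdiv_prime nm; have pn := dvdn_trans (pdiv_dvd (n %/ m)) (dvdn_div mn).
have /np : pdiv (n %/ m) \in primes n by rewrite mem_primes pp n0.
rewrite -(prim_order_dvd pm) => /negP[].
set q := (n %/ m)%N; have -> : n = (m * q)%N by rewrite mulnC divnK.
by rewrite -muln_divA ?pdiv_dvd // dvdn_mulr.
Qed.

End CyclicSubgroups.

Arguments cycle_of_id {A} x.

(** * Isomorphisms with finite groups *)

Section FiniteModels.
Variables A B : unitRingType.
Implicit Types (H : set A) (x y g h : A).

Lemma isom_fin_isog (gT rT : finGroupType) (G : {group gT}) (K : {group rT}) H :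
  K \isog G -> isom_fin G H -> isom_fin K H.
Proof.
case/isogP=> u /injmP uI uK [f [fH fI fs] fM].
exists (f \o u).
  split=> [a /= Ka|a b /set_mem /= Ka /set_mem /= Kb fab|x Hx].
  - by apply: fH; rewrite /= -uK mem_morphim.
  - by apply: uI => //; apply: fI; rewrite // mem_set //= -uK mem_morphim.
  - have [a] := fs x Hx; rewrite /= -uK => /morphimP[b Kb _ ->] <-.
    by exists b.
by move=> a b Ka Kb; rewrite /= morphM // fM // -uK mem_morphim.
Qed.

(** Used to replace a group of matrices by an explicit one of the same isomorphism
type. The map goes back along the first isomorphism and forth along the
second. *)
Lemma isom_fin_sub (gT : finGroupType) (G : {group gT}) H (L : set B) :
  isom_fin G H -> isom_fin G L -> isom_sub H L.
Proof.
case=> [f [fH fI fs] fM] [e [eL eI es] eM].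
have /choice[u uP] : forall x : A, exists a : gT, H x -> a \in G /\ f a = x.
  move=> x; case: (pselect (H x)) => [/fs[a Ga fa]|nHx]; first by exists a.
  by exists 1%g.
have fu a : a \in G -> u (f a) = a.
  move=> Ga; have [Gu fua] := uP _ (fH a Ga).
  by apply: fI; rewrite ?mem_set.
exists (e \o u).
  split=> [x Hx|x y /set_mem Hx /set_mem Hy euxy|z /es[a Ga <-]].
  - by apply: eL; case: (uP x Hx).
  - have [[Gx <-] [Gy <-]] := (uP x Hx, uP y Hy).
    by congr f; apply: eI; rewrite ?mem_set.
  - by exists (f a); [apply: fH|rewrite /= fu].
move=> x y /set_mem Hx /set_mem Hy /=.
have [[Gx fx] [Gy fy]] := (uP x Hx, uP y Hy).
by rewrite -{1}fx -{1}fy -fM // fu ?groupM // eM.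
Qed.

Lemma isom_sub_refl H : isom_sub H H.
Proof.
by exists id => //; split=> [x|x y|x Hx] //; exists x.
Qed.

Lemma isom_fin_card (gT : finGroupType) (G : {group gT}) H :
  isom_fin G H -> has_card H #|G|.
Proof.
case=> [f [fH fI fs] _]; have {fs}-> : H = f @` [set` G].
  by apply/seteqP; split=> [x /fs //|_ [a Ga <-]]; apply: fH.
apply: card_eq_trans (inj_card_eq fI) _.
have -> : [set` G] = (fun a => enum_val a) @` [set: 'I_#|G|].
  apply/seteqP; split=> [a /= Ga|_ [i _ <-]]; last exact: enum_valP.
  by exists (enum_rank_in Ga a) => //; rewrite enum_rankK_in.
apply: card_eq_trans (inj_card_eq _) _; first by move=> i j _ _ /enum_val_inj.
by rewrite card_eq_sym card_II.
Qed.

(** Injectivity is where the trivial intersection enters: if f b * e d equals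
f a * e c, then (f b)^-1 * f a = e d * (e c)^-1 lies in both factors. *)
Lemma isom_fin_dprod (gT rT : finGroupType) (G : {group gT}) (K : {group rT})
    (H1 H2 H : set A) :
    is_subgroup H1 -> is_subgroup H2 -> internal_dprod H1 H2 H ->
    isom_fin G H1 -> isom_fin K H2 ->
  isom_fin (finset.setX G K) H.
Proof.
move=> s1 s2 [-> HI Hc] [f [fH fI fs] fM] [e [eH eI es] eM].
exists (fun u => f u.1 * e u.2).
  split=> [[a c] /finset.setXP[/= Ga Kc]|[a c] [b d]|_ [x H1x [y H2y <-]]].
  - by exists (f a); [apply: fH|exists (e c) => //; apply: eH].
  - move=> /set_mem /finset.setXP[/= Ga Kc] /set_mem /finset.setXP[/= Gb Kd] E.
    have [faU ebU] : f b \is a GRing.unit /\ e c \is a GRing.unit.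
      by split; [apply: (subgroup_unit s1 (fH _ Gb))
                |apply: (subgroup_unit s2 (eH _ Kc))].
    have E1 : (f b)^-1 * f a = e d * (e c)^-1.
      apply: (mulrI faU); apply: (mulIr ebU).
      by rewrite !mulrA mulrV // mul1r E divrK.
    have : (H1 `&` H2) ((f b)^-1 * f a).
      split; first by apply: subgroupM => //; [apply: subgroupV => //|]; apply: fH.
      by rewrite E1; apply: subgroupM => //; [|apply: subgroupV => //]; apply: eH.
    rewrite HI => /= I1; congr (_, _).
      apply: fI; rewrite ?mem_set //.
      by rewrite -[LHS](mulVKr faU) I1 mulr1.
    apply: eI; rewrite ?mem_set //; apply/esym.
    by rewrite -[LHS](divrK ebU) -E1 I1 mul1r.
  - have [[a Ga <-] [c Kc <-]] := (fs x H1x, es y H2y).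
    by exists (a, c) => //; apply/finset.setXP.
move=> [a c] [b d] /finset.setXP[/= Ga Kc] /finset.setXP[/= Gb Kd].
rewrite fM // eM // -!mulrA; congr (_ * _); rewrite !mulrA; congr (_ * _).
by apply: Hc; apply/mem_set; [apply: fH|apply: eH].
Qed.

End FiniteModels.

Section Cayley.
Variable A : unitRingType.

(** Cayley's theorem: a finite group H of units is represented by the
permutations p of its elements such that p y = y * p 1, i.e. by the right
translations. *)
Lemma finite_subgroup_isom_fin (H : set A) : is_subgroup H -> finite_set H ->
  exists (gT : finGroupType) (G : {group gT}), isom_fin G H.
Proof.
move=> sH /finite_seqP[s Hs].
have inH x : H x -> x \in s by rewrite Hs.
have Hin x : x \in s -> H x by rewrite Hs.
pose T := seq_sub s; pose e : T := SeqSub (inH _ (subgroup1 sH)).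
pose R := [set p : {perm T} | [forall y : T, val (p y) == val y * val (p e)]]%SET.
have RP (p : {perm T}) : reflect (forall y, val (p y) = val y * val (p e)) (p \in R).
  by rewrite inE; apply: (iffP 'forall_eqP).
have groupR : group_set R.
  apply/group_setP; split=> [|p q /RP Rp /RP Rq].
    by apply/RP => y; rewrite !perm1 mulr1.
  by apply/RP => y; rewrite !permM Rq Rp [in RHS]Rq mulrA.
exists {perm T}, (Group groupR), (fun p : {perm T} => val (p e)).
  split=> [p _|p q /set_mem /= /RP Rp /set_mem /= /RP Rq pq|x Hx].
  - exact/Hin/valP.
  - by apply/permP => y; apply: val_inj; rewrite Rp Rq; congr (_ * _).
  - have xU := subgroup_unit sH Hx.
    pose r (y : T) : T := SeqSub (inH _ (subgroupM sH (Hin _ (valP y)) Hx)).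
    have rI : injective r.
      by move=> y z /(congr1 val) /= /(mulIr xU); apply: val_inj.
    exists (perm rI); last by rewrite /= permE /= mul1r.
    by apply/RP => y; rewrite !permE /= mul1r.
by move=> p q /RP Rp /RP Rq; rewrite permM Rq.
Qed.

End Cayley.

(** * A presentation by two generators, one inverting the other *)

Section Presentation.
Local Open Scope group_scope.

Lemma card_cycle_join (gT : finGroupType) (x y : gT) : y \in 'N(<[x]>) ->
  #|<[x]> <*> <[y]>| = (#[x] * #[coset <[x]> y])%N.
Proof.
move=> Nxy; have nxy : <[y]> \subset 'N(<[x]>) by rewrite cycle_subG.
rewrite -(LagrangeI _ <[x]>) (finset.setIidPr (joing_subl _ _)) -orderE.
rewrite -card_quotient ?join_subG ?normG //.
by rewrite quotientYidl // quotient_cycle.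
Qed.

Lemma norm_inverting (gT : finGroupType) (x y : gT) :
  y * x * y^-1 = x^-1 -> y \in 'N(<[x]>).
Proof.
move=> yx; rewrite -groupV; apply/normP.
by rewrite -cycleJ conjgE invgK mulgA yx cycleV.
Qed.

(** The group generated by y normalises that generated by x, and in the
quotient the s-th power of y is trivial. *)
Lemma card_cycle_join_le (gT : finGroupType) (x y : gT) (n s k : nat) :
    (0 < n)%N -> (0 < s)%N -> x ^+ n = 1 -> y ^+ s = x ^+ k ->
    y * x * y^-1 = x^-1 ->
  (#|<[x]> <*> <[y]>| <= n * s)%N.
Proof.
move=> n0 s0 xn ys yx; have Nxy := norm_inverting yx.
rewrite card_cycle_join // leq_mul // dvdn_leq // order_dvdn ?xn //.
by rewrite -morphX //= ys coset_id // mem_cycle.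
Qed.

Lemma expg_pair (gT rT : finGroupType) (x : gT) (u : rT) n :
  (x, u) ^+ n = (x ^+ n, u ^+ n).
Proof. by elim: n => // n IHn; rewrite !expgS IHn. Qed.

(** To see that any group generated by u and v subject to the relations is an
image of G, consider the subgroup D of the direct product generated by (x, u)
and (y, v).  The relations bound the order of D by that of G, so the
projection of D onto G is bijective; D also projects onto <u, v>. *)
Lemma isog_Grp_inverting (gT : finGroupType) (G : {group gT}) (x y : gT)
    (n s k : nat) :
    (0 < n)%N -> (0 < s)%N -> G :=: <[x]> <*> <[y]> -> #|G| = (n * s)%N ->
    x ^+ n = 1 -> y ^+ s = x ^+ k -> y * x * y^-1 = x^-1 ->
  G \isog Grp (g : h : g ^+ n, h ^+ s = g ^+ k, h * g * h^-1 = g^-1).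
Proof.
move=> n0 s0 defG oG xn ys yx; apply: intro_isoGrp.
  apply/existsP; exists (x, y); rewrite /= !xpair_eqE /=.
  by rewrite -defG xn ys yx !eqxx.
move=> rT K /existsP[[u v] /eqP[defK un vs vu]].
pose D := <[(x, u)]> <*> <[(y, v)]>.
have oD : (#|D| <= #|G|)%N.
  rewrite oG; apply: (card_cycle_join_le (k := k)) => //.
  - by rewrite expg_pair xn un.
  - by rewrite !expg_pair ys vs.
  - by apply/eqP; rewrite xpair_eqE; apply/andP; split; apply/eqP.
have fstD : fst_morphism gT rT @* D = G.
  rewrite /D morphimY ?finset.subsetT //.
  by rewrite !(morphim_cycle (fst_morphism gT rT)) ?inE //= -defG.
have sndD : snd_morphism gT rT @* D = K.
  rewrite /D morphimY ?finset.subsetT //.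
  by rewrite !(morphim_cycle (snd_morphism gT rT)) ?inE.
have isoGD : G \isog [group of D].
  rewrite isogEcard oD andbT -fstD.
  by apply: morphim_homg; apply: finset.subsetT.
have homKD : K \homg [group of D].
  by rewrite -sndD; apply: morphim_homg; apply: finset.subsetT.
by apply: homg_trans homKD _; apply: isog_hom; rewrite isog_sym.
Qed.

End Presentation.

Section Metacyclic.
Variable A : unitRingType.
Implicit Types (H : set A) (x y g h : A).

Definition prods g h : set A :=
  [set x | exists a b : nat, x = g ^+ a * h ^+ b].

Lemma prods_l g h a : prods g h (g ^+ a).
Proof. by exists a, 0%N; rewrite mulr1. Qed.

Lemma prods_r g h b : prods g h (h ^+ b).
Proof. by exists 0%N, b; rewrite mul1r. Qed.

(** Moving the powers of g to the left of the powers of h by the relation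
h * g = g ^+ j * h shows that these products are closed under multiplication;
j = 1 is the commuting case and j = n.-1 the inverting one. *)
Lemma subgroup_prods n m j g h :
    n.-primitive_root g -> m.-primitive_root h -> h * g = g ^+ j * h ->
  is_subgroup (prods g h).
Proof.
move=> pg ph hg; have [gU hU] := (prim_root_unit pg, prim_root_unit ph).
have hgX a : h * g ^+ a = g ^+ (j * a) * h.
  elim: a => [|a IHa]; first by rewrite muln0 mulr1 mul1r.
  by rewrite exprSr mulrA IHa -mulrA hg mulrA -exprD mulnSr.
have hXgX b a : h ^+ b * g ^+ a = g ^+ (j ^ b * a) * h ^+ b.
  elim: b => [|b IHb]; first by rewrite mul1n mulr1 mul1r.
  by rewrite exprS -mulrA IHb mulrA hgX -mulrA -exprS mulnA -expnS.
have closed a b a' b' : prods g h (g ^+ a * h ^+ b * (g ^+ a' * h ^+ b')).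
  exists (a + j ^ b * a')%N, (b + b')%N.
  by rewrite mulrA -(mulrA (g ^+ a)) hXgX mulrA -!exprD -mulrA -exprD.
apply: subgroup_intro.
- by move=> _ [a [b ->]]; rewrite unitrMl unitrX.
- by exists 0%N, 0%N; rewrite mulr1.
- by move=> _ _ [a [b ->]] [a' [b' ->]].
move=> _ [a [b ->]]; rewrite invrM ?unitrX // -!exprVn.
rewrite (prim_root_invE pg) (prim_root_invE ph) -!exprM.
by have := closed 0%N (m.-1 * b)%N (n.-1 * a)%N 0%N; rewrite mul1r mulr1.
Qed.

Lemma prods_sub H g h : is_subgroup H -> H g -> H h -> prods g h `<=` H.
Proof.
by move=> sH Hg Hh _ [a [b ->]]; apply: subgroupM => //; apply: subgroupX.
Qed.

Lemma gen_prods n m j g h :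
    n.-primitive_root g -> m.-primitive_root h -> h * g = g ^+ j * h ->
  gen [set g; h] = prods g h.
Proof.
move=> pg ph hg; have [gU hU] := (prim_root_unit pg, prim_root_unit ph).
apply/seteqP; split=> [x|].
  apply; split; first exact: subgroup_prods pg ph hg.
  by move=> _ [] ->; [apply: (prods_l g h 1)|apply: (prods_r g h 1)].
apply: prods_sub => [|H [_ ghH]|H [_ ghH]].
- by apply: subgroup_gen => _ [] ->.
- by apply: ghH; left.
- by apply: ghH; right.
Qed.

Lemma finite_prods n m g h :
    n.-primitive_root g -> m.-primitive_root h ->
  finite_set (prods g h).
Proof.
move=> pg ph.
apply: (sub_finite_set (B := (fun u : A * A => u.1 * u.2) @`
                              (cycle_of g `*` cycle_of h))).
  move=> _ [a [b ->]]; exists (g ^+ a, h ^+ b) => //.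
  by split=> /=; apply: cycle_ofX; [apply: prim_root_unit pg|apply: prim_root_unit ph].
by apply/finite_image/finite_setX; apply: finite_cycle_of; eassumption.
Qed.

Lemma dprod_prods n m g h :
    n.-primitive_root g -> m.-primitive_root h -> g * h = h * g ->
    (forall b, cycle_of g (h ^+ b) -> h ^+ b = 1) ->
  internal_dprod (cycle_of g) (cycle_of h) (prods g h).
Proof.
move=> pg ph gh cap; split.
- rewrite (cycle_ofE pg) (cycle_ofE ph); apply/seteqP; split.
    move=> _ [a [b ->]]; rewrite -(prim_expr_mod pg) -(prim_expr_mod ph).
    exists (g ^+ (a %% n)).
      by exists (a %% n)%N; rewrite ?ltn_mod ?(prim_order_gt0 pg).
    exists (h ^+ (b %% m)) => //.
    by exists (b %% m)%N; rewrite ?ltn_mod ?(prim_order_gt0 ph).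
  by move=> _ [_ [a _ ->] [_ [b _ ->] <-]]; exists a, b.
- apply/seteqP; split=> [x [gx]|_ ->]; last first.
    by split; apply: subgroup1; apply: subgroup_cycle;
      [apply: prim_root_unit pg|apply: prim_root_unit ph].
  by rewrite (cycle_ofE ph) => -[b _ xb]; move: gx; rewrite xb; apply: cap.
- move=> x y; rewrite (cycle_ofE pg) (cycle_ofE ph).
  by move=> /set_mem[a _ ->] /set_mem[b _ ->]; apply/commrX/commr_sym/commrX.
Qed.

Lemma isom_fin_prods n m g h : (1 < n)%N -> (1 < m)%N ->
    n.-primitive_root g -> m.-primitive_root h -> g * h = h * g ->
    (forall b, cycle_of g (h ^+ b) -> h ^+ b = 1) ->
  isom_fin (finset.setX (Zp n) (Zp m)) (prods g h).
Proof.
move=> n1 m1 pg ph gh cap.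
apply: (isom_fin_dprod (H1 := cycle_of g) (H2 := cycle_of h)).
- exact: subgroup_cycle (prim_root_unit pg).
- exact: subgroup_cycle (prim_root_unit ph).
- exact: dprod_prods pg ph gh cap.
- exact: isom_fin_cycle.
- exact: isom_fin_cycle.
Qed.

(** The order of G is n * s because the powers of h fall into exactly s cosets
of the cyclic group generated by g. *)
Lemma isom_fin_prods_inverting n s k m g h :
    n.-primitive_root g -> m.-primitive_root h -> (0 < s)%N ->
    h ^+ s = g ^+ k -> h * g * h^-1 = g^-1 ->
    (forall b, cycle_of g (h ^+ b) -> (s %| b)%N) ->
  exists (gT : finGroupType) (G : {group gT}),
    [/\ isom_fin G (prods g h), #|G| = (n * s)%N &
      (G \isog Grp (g : h : g ^+ n, h ^+ s = g ^+ k, h * g * h^-1 = g^-1))%g].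
Proof.
move=> pg ph s0 hs hg cap.
have n0 := prim_order_gt0 pg.
have [gU hU] := (prim_root_unit pg, prim_root_unit ph).
have hg' : h * g = g ^+ n.-1 * h.
  by rewrite -(prim_root_invE pg) -hg divrK.
have sP := subgroup_prods pg ph hg'.
have [gT [G isoG]] := finite_subgroup_isom_fin sP (finite_prods pg ph).
have [f fB fM] := isoG; have [fH fI fs] := fB.
have f1 := isom_fin1 sP fB fM.
have finj a b : a \in G -> b \in G -> f a = f b -> a = b.
  by move=> Ga Gb; apply: fI; rewrite mem_set.
have fX a i : a \in G -> f (a ^+ i)%g = f a ^+ i.
  move=> Ga; elim: i => [|i IHi]; first by rewrite expg0 f1.
  by rewrite expgS exprS fM ?groupX // IHi.
have [x Gx fx] := fs _ (prods_l g h 1); rewrite expr1 in fx.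
have [y Gy fy] := fs _ (prods_r g h 1); rewrite expr1 in fy.
have fV a : a \in G -> f a^-1%g = (f a)^-1.
  move=> Ga; have faU := subgroup_unit sP (fH _ Ga).
  by apply: (mulIr faU); rewrite -fM ?groupV // mulVg f1 mulVr.
have ys : (y ^+ s = x ^+ k)%g by apply: finj; rewrite ?groupX // !fX // fx fy.
have yx : (y * x * y^-1 = x^-1)%g.
  apply: finj; rewrite ?groupM ?groupV ?groupM // !fM ?fV ?groupV ?groupM //.
  by rewrite fx fy.
have xn : (x ^+ n = 1)%g.
  by apply: finj; rewrite ?groupX // fX // fx f1 (prim_expr_order pg).
have defG : G :=: (<[x]> <*> <[y]>)%g.
  apply/eqP; rewrite finset.eqEsubset; apply/andP; split; last first.
    by rewrite join_subG !cycle_subG Gx Gy.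
  apply/fintype.subsetP => a Ga; have [i [j faE]] := fH _ Ga.
  have -> : a = (x ^+ i * y ^+ j)%g.
    by apply: finj; rewrite ?groupM ?groupX // fM ?groupX // !fX // fx fy.
  by rewrite groupM ?groupX // -cycle_subG ?joing_subl ?joing_subr.
have cycE i : (y ^+ i \in <[x]>)%g -> cycle_of g (h ^+ i).
  by case/cycleP=> j yij; rewrite -fy -fX // yij fX // fx; apply: cycle_ofX.
have ox : #[x]%g = n.
  apply/eqP; rewrite eqn_dvd order_dvdn xn eqxx /=.
  by rewrite (prim_order_dvd pg) -fx -fX // expg_order f1.
have Nxy := norm_inverting yx.
have oy : #[coset <[x]> y]%g = s.
  apply/eqP; rewrite eqn_dvd order_dvdn -morphX //= ys coset_id ?mem_cycle // eqxx /=.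
  apply: cap; apply: cycE; apply: coset_idr; first by rewrite groupX.
  by rewrite morphX // expg_order.
have oG : #|G| = (n * s)%N by rewrite defG card_cycle_join // ox oy.
by exists gT, G; split=> //; apply: (isog_Grp_inverting n0 s0 defG).
Qed.

End Metacyclic.

(** * Matrices of size 2 *)

Section Matrices2.
Variable F : fieldType.
Implicit Types (M N : 'M[F]_2) (a b c d : F).

Definition mx2 a b c d : 'M[F]_2 :=
  \matrix_(i, j) if i == 0 then if j == 0 then a else b
                 else if j == 0 then c else d.

Lemma mx2_eta M : M = mx2 (M 0 0) (M 0 1) (M 1 0) (M 1 1).
Proof.
apply/matrixP => i j; rewrite mxE.
by case: i => [[|[|]]] //= hi; case: j => [[|[|]]] //= hj; congr (M _ _);
  apply: val_inj.
Qed.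

Lemma eq_mx2 M N : M 0 0 = N 0 0 -> M 0 1 = N 0 1 -> M 1 0 = N 1 0 ->
  M 1 1 = N 1 1 -> M = N.
Proof. by rewrite [M]mx2_eta [N]mx2_eta !mxE /= => -> -> -> ->. Qed.

Lemma scalar_mx2 a : a%:M = mx2 a 0 0 a.
Proof. by apply: eq_mx2; rewrite !mxE. Qed.

Lemma mx2M a b c d a' b' c' d' :
  mx2 a b c d * mx2 a' b' c' d' =
  mx2 (a * a' + b * c') (a * b' + b * d') (c * a' + d * c') (c * b' + d * d').
Proof.
by apply: eq_mx2; rewrite !mxE !big_ord_recl big_ord0 !mxE /= addr0.
Qed.

Lemma det_mx2E (R : comNzRingType) (M : 'M[R]_2) :
  \det M = M 0 0 * M 1 1 - M 0 1 * M 1 0.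
Proof.
rewrite (expand_det_row M 0) !big_ord_recl big_ord0 addr0 /cofactor !det_mx11.
rewrite !mxE /= expr0 expr1 mul1r mulN1r mulrN.
by congr (_ * M _ _ - M _ _ * M _ _); apply: val_inj.
Qed.

Lemma det_mx2 a b c d : \det (mx2 a b c d) = a * d - b * c.
Proof. by rewrite det_mx2E !mxE. Qed.

Lemma tr_mx2 a b c d : \tr (mx2 a b c d) = a + d.
Proof. by rewrite /mxtrace !big_ord_recl big_ord0 !mxE /= addr0. Qed.

Lemma detM M N : \det (M * N) = \det M * \det N.
Proof. exact: det_mulmx. Qed.

Lemma detX M k : \det (M ^+ k) = \det M ^+ k.
Proof. by elim: k => [|k IHk]; rewrite ?det1 // !exprS detM IHk. Qed.

Lemma detV M : M \is a GRing.unit -> \det M^-1 = (\det M)^-1.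
Proof. by move=> MU; apply: det_inv. Qed.

Lemma tr_swap M N : \tr (M * N) = \tr (N * M).
Proof. exact: mxtrace_mulC. Qed.

(** The Cayley-Hamilton theorem in size 2. *)
Lemma sqr_mx2 M : M ^+ 2 = (\tr M)%:M * M - (\det M)%:M.
Proof.
rewrite [M]mx2_eta; move: (M 0 0) (M 0 1) (M 1 0) (M 1 1) => a b c d.
rewrite tr_mx2 det_mx2 !scalar_mx2 expr2 !mx2M.
by apply: eq_mx2; rewrite !mxE /=; ring.
Qed.

Lemma eigenvalues_mx2 M a b : \tr M = a + b -> \det M = a * b ->
  char_poly M = ('X - a%:P) * ('X - b%:P).
Proof.
rewrite [M]mx2_eta; move: (M 0 0) (M 0 1) (M 1 0) (M 1 1) => x y z t.
rewrite tr_mx2 det_mx2 => Etr Edet.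
rewrite /char_poly det_mx2E !mxE /= !mulr1n !mulr0n !sub0r mulrNN.
transitivity ('X ^+ 2 - 'X * (x + t)%:P + (x * t - y * z)%:P).
  by rewrite !rmorphD !rmorphN !rmorphM /=; ring.
by rewrite Etr Edet !rmorphD !rmorphM /=; ring.
Qed.

Lemma mx2N a b c d : - mx2 a b c d = mx2 (- a) (- b) (- c) (- d).
Proof. by apply: eq_mx2; rewrite !mxE. Qed.

Lemma mxN1 : -1 = (-1)%:M :> 'M[F]_2.
Proof. by rewrite rmorphN rmorph1. Qed.

Lemma scalar_mx2N a : - a%:M = (- a)%:M :> 'M[F]_2.
Proof. by rewrite rmorphN. Qed.

Lemma scalar_mx2X a n : (a%:M : 'M[F]_2) ^+ n = (a ^+ n)%:M.
Proof. by rewrite rmorphXn. Qed.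

Lemma scalar_mx2_inj a b : a%:M = b%:M :> 'M[F]_2 -> a = b.
Proof. by move/(congr1 (fun M : 'M_2 => M 0 0)); rewrite !mxE. Qed.

Lemma tr_sqr M : \tr (M ^+ 2) = \tr M ^+ 2 - 2 * \det M.
Proof.
rewrite [M]mx2_eta expr2 mx2M !tr_mx2 det_mx2.
by move: (M 0 0) (M 0 1) (M 1 0) (M 1 1) => a b c d; ring.
Qed.

Lemma sqr_tr0 M : \tr M = 0 -> M ^+ 2 = (- \det M)%:M.
Proof. by move=> t0; rewrite sqr_mx2 t0 rmorph0 mul0r sub0r rmorphN. Qed.

(** By the Cayley-Hamilton theorem tr(M) M = M^2 + det(M) is a scalar, so that
M itself is one as soon as its trace can be inverted. When the trace is 0 the
square of M is the scalar -det(M), see sqr_tr0. Every exclusion of a case in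
the classification rests on this alternative. *)
Lemma scalar_or_tr0 M c : M ^+ 2 = c%:M -> \tr M = 0 \/ exists a, M = a%:M.
Proof.
move=> M2; have [->|t0] := eqVneq (\tr M) 0; [by left|right].
exists ((\tr M)^-1 * (c + \det M)).
have : (\tr M)%:M * M = (c + \det M)%:M by rewrite rmorphD /= -M2 sqr_mx2 subrK.
move/(congr1 (fun N => (\tr M)^-1%:M * N)); rewrite mulrA -!rmorphM /=.
by rewrite mulVf // rmorph1 mul1r.
Qed.

End Matrices2.

(** * Square roots of negative integers and points of the unit circle *)

Section ComplexNumbers.
Variable K : realType.
Local Notation C := K[i].

Definition sqrtN (d : nat) : C := 0 +i* Num.sqrt (d%:R : K).

Lemma sqr_sqrtN d : sqrtN d ^+ 2 = - d%:R.
Proof.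
rewrite expr2 /sqrtN; simpc; rewrite -expr2 sqr_sqrtr ?ler0n //.
by rewrite -(rmorph_nat (real_complex K)) -rmorphN.
Qed.

Lemma sqrtN_i : sqrtN 1 = 'i%R.
Proof. by rewrite /sqrtN sqrtr1 -complexiE. Qed.

Lemma sqrtN_uniq d z : z ^+ 2 = - d%:R -> z = sqrtN d \/ z = - sqrtN d.
Proof. by move/eqP; rewrite -sqr_sqrtN eqf_sqr => /orP[]/eqP; [left|right]. Qed.

Lemma conj_sqrtN d : (sqrtN d)^* = - sqrtN d.
Proof. by rewrite /sqrtN; simpc. Qed.

Lemma expiD (s t : K) : expi (s + t) = expi s * expi t.
Proof. by rewrite /expi cosD sinD; simpc; congr (_ +i* _); rewrite addrC. Qed.

Lemma expi0 : expi 0 = 1 :> C.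
Proof. by rewrite /expi cos0 sin0. Qed.

Lemma expi_neq0 (t : K) : expi t != 0 :> C.
Proof.
have e : expi (- t) * expi t = 1 by rewrite -expiD addNr expi0.
by apply: contra_eqN e => /eqP->; rewrite mulr0 eq_sym oner_eq0.
Qed.

Lemma expiX (t : K) n : expi t ^+ n = expi (t *+ n).
Proof. by elim: n => [|n IHn]; rewrite ?expi0 // exprS IHn mulrS expiD. Qed.

Lemma expi_pi : expi pi = -1 :> C.
Proof. by rewrite /expi cospi sinpi; apply/eqP; rewrite eq_complex /= oppr0 !eqxx. Qed.

Lemma expi_pihalf : expi (pi / 2) = 'i%R :> C.
Proof. by rewrite /expi cos_pihalf sin_pihalf -complexiE. Qed.

(** No value of the cosine is needed: z = exp(i pi / 4) satisfies z^4 = -1, hence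
(z + z^3)^2 = -2, and the sign is that of the sines. *)
Lemma expi_pi4 : expi (pi / 4) + expi (3 * pi / 4) = sqrtN 2.
Proof.
have z4 : expi (pi / 4) ^+ 4 = -1 :> C.
  by rewrite expiX -expi_pi; congr expi; field.
have z3 : expi (3 * pi / 4) = expi (pi / 4) ^+ 3 :> C.
  by rewrite expiX; congr expi; field.
have : (expi (pi / 4) + expi (3 * pi / 4)) ^+ 2 = - 2%:R :> C.
  by rewrite z3; move: (expi _) z4 => z z4; ring: z4.
case/sqrtN_uniq => // /(congr1 (@complex.Im K)) /=.
have s4 : 0 < sin (pi / 4 : K).
  by apply: sin_gt0_pi; have := pi_gt0 K; move=> ?; apply/andP; split; lra.
have s34 : 0 < sin (3 * pi / 4 : K).
  by apply: sin_gt0_pi; have := pi_gt0 K; move=> ?; apply/andP; split; lra.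
have : 0 <= Num.sqrt (2 : K) by apply: sqrtr_ge0.
by clear z3 z4; move=> *; exfalso; lra.
Qed.

(** Here z = exp(i pi / 3) satisfies z^3 = -1 and differs from -1, so it is a
root of (X^3 + 1) / (X + 1) = X^2 - X + 1. *)
Lemma expi_pi3 : expi (pi / 3) ^+ 2 = expi (pi / 3) - 1 :> C.
Proof.
have z3 : expi (pi / 3) ^+ 3 = -1 :> C.
  by rewrite expiX -expi_pi; congr expi; field.
have z1 : expi (pi / 3) + 1 != 0 :> C.
  apply/eqP => /(congr1 (@complex.Im K)) /=; rewrite addr0 => s0.
  have : 0 < sin (pi / 3 : K).
    by apply: sin_gt0_pi; have := pi_gt0 K; move=> ?; apply/andP; split; lra.
  by rewrite s0 ltxx.
apply/eqP; rewrite -subr_eq0; apply/eqP/(mulfI z1).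
by rewrite mulr0; transitivity (expi (pi / 3) ^+ 3 + 1 : C); [ring|rewrite z3; ring].
Qed.

Lemma expi_2pi3 : expi (2 * pi / 3) = expi (pi / 3) - 1 :> C.
Proof. by rewrite -expi_pi3 expiX; congr expi; field. Qed.

End ComplexNumbers.

Section RootsOfUnity.
Variable K : realType.
Local Notation C := K[i].

Lemma expiDpi (t : K) : expi (t + pi) = - expi t.
Proof. by rewrite expiD expi_pi mulrN1. Qed.

Lemma expi_pi3E : expi (pi / 3) = (1 + sqrtN K 3) / 2 :> C.
Proof.
have : (2 * expi (pi / 3) - 1) ^+ 2 = - 3%:R :> C.
  by have := expi_pi3 K; move: (expi _) => z z2; ring: z2.
case/sqrtN_uniq => E.
  by rewrite -E; move: (expi _) => z; field.
have s3 : 0 < sin (pi / 3 : K).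
  by apply: sin_gt0_pi; have := pi_gt0 K; move=> ?; apply/andP; split; lra.
have : 0 <= Num.sqrt (3 : K) by apply: sqrtr_ge0.
have /(congr1 (@complex.Im K)) /= : expi (pi / 3) + expi (pi / 3) = 1 - sqrtN K 3.
  by rewrite -E; ring.
by clear E; rewrite sub0r => *; exfalso; lra.
Qed.

Lemma N1_neq1 : -1 != 1 :> C.
Proof.
rewrite -subr_eq0 -opprD oppr_eq0 -[1 + 1]/(2%:R) pnatr_eq0 //.
Qed.

Lemma prim_i : 4.-primitive_root ('i%R : C).
Proof.
have i2 := sqrCi C; apply: prim_root_primes => //.
  by rewrite -[4%N]/(2 * 2)%N exprM i2 sqrrN expr1n.
by rewrite /= i2 N1_neq1.
Qed.

Lemma prim_N1 : 2.-primitive_root (-1 : C).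
Proof.
by apply: prim_root_primes; rewrite ?sqrrN ?expr1n //= expr1 N1_neq1.
Qed.

Lemma prim_pi4 : 8.-primitive_root (expi (pi / 4) : C).
Proof.
have z4 : expi (pi / 4) ^+ 4 = -1 :> C.
  by rewrite expiX -expi_pi; congr expi; field.
apply: prim_root_primes; rewrite //= ?z4 ?N1_neq1 //.
by rewrite -[8%N]/(4 * 2)%N exprM z4 sqrrN expr1n.
Qed.

Lemma prim_pi3 : 6.-primitive_root (expi (pi / 3) : C).
Proof.
have z2 := expi_pi3 K; move: (expi _) z2 => z z2.
have z3 : z ^+ 3 = -1 by ring: z2.
apply: prim_root_primes => //; first by rewrite -[6%N]/(3 * 2)%N exprM z3 sqrrN expr1n.
rewrite /= z3 N1_neq1 andbT.
apply/negP => /eqP z21; have : z ^+ 3 = z by rewrite exprS z21 mulr1.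
rewrite z3 => zN1; rewrite -zN1 in z2.
have : 3%:R = (-1) ^+ 2 - (-1 - 1) :> C by ring.
by rewrite z2 subrr => /eqP; rewrite pnatr_eq0.
Qed.

Lemma prim_2pi3 : 3.-primitive_root (expi (2 * pi / 3) : C).
Proof.
rewrite expi_2pi3 -expi_pi3.
exact: (@dvdn_prim_root _ _ _ prim_pi3 3).
Qed.

End RootsOfUnity.

(** * Subrings and subfields of the complex numbers *)

Section Subrings.
Variable K : realType.
Local Notation C := K[i].
Implicit Types (R F : set C) (a b z : C).

Definition is_subring R :=
  [/\ R 1, forall a b, R a -> R b -> R (a - b) &
      forall a b, R a -> R b -> R (a * b)].

Lemma subring0 R : is_subring R -> R 0.
Proof. by case=> R1 RB _; rewrite -(subrr (1 : C)); apply: RB. Qed.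

Lemma subringN R a : is_subring R -> R a -> R (- a).
Proof.
move=> sR Ra; have R0 := subring0 sR.
by case: sR => _ RB _; rewrite -sub0r; apply: RB.
Qed.

Lemma subringD R a b : is_subring R -> R a -> R b -> R (a + b).
Proof.
move=> sR Ra Rb; have RNb := subringN sR Rb.
by case: sR => _ RB _; rewrite -[b]opprK; apply: RB.
Qed.

Lemma subringM R a b : is_subring R -> R a -> R b -> R (a * b).
Proof. by case=> _ _; apply. Qed.

Lemma subring_int R (m : int) : is_subring R -> R m%:~R.
Proof.
move=> sR; have nat_in n : R n%:R.
  elim: n => [|n IHn]; first exact: subring0.
  by rewrite -natr1; apply: subringD => //; case: sR.
case: m => n; first exact: nat_in.
by rewrite NegzE rmorphN; apply: subringN => //; apply: nat_in.
Qed.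

Lemma subringX R a n : is_subring R -> R a -> R (a ^+ n).
Proof.
move=> sR Ra; elim: n => [|n IHn]; first by case: sR.
by rewrite exprS; apply: subringM.
Qed.

Lemma Zi_subring : is_subring (Zi K).
Proof.
split.
- by exists 1, 0; rewrite mul0r addr0.
- move=> _ _ [a [b ->]] [c [d ->]]; exists (a - c), (b - d).
  by rewrite !rmorphB /=; ring.
- move=> _ _ [a [b ->]] [c [d ->]]; exists (a * c - b * d), (a * d + b * c).
  rewrite !(rmorphB, rmorphD, rmorphM) /=.
  by have := sqrCi C; move: 'i%R => i i2; ring: i2.
Qed.

Definition is_subfield F := is_subring F /\ forall a, F a -> F a^-1.

Lemma subfieldP F : divring_closed [in F] <-> is_subfield F.
Proof.
split=> [[F1 FB Fd]|[[F1 FB FM] FV]].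
  have F1' : F 1 by apply/set_mem.
  have Fd' a b : F a -> F b -> F (a / b).
    by move=> Fa Fb; apply/set_mem/Fd; apply/mem_set.
  have FV a : F a -> F a^-1 by move=> Fa; rewrite -[a^-1]mul1r; apply: Fd'.
  split=> //; split=> // [a b Fa Fb|a b Fa Fb].
    by apply/set_mem/FB; apply/mem_set.
  by rewrite -[b]invrK; apply/Fd'/FV.
split; first exact/mem_set.
  by move=> a b /set_mem Fa /set_mem Fb; apply/mem_set/FB.
by move=> a b /set_mem Fa /set_mem Fb; apply/mem_set/FM => //; apply: FV.
Qed.

Lemma subfield_field_gen (S : set C) : is_subfield (field_gen S).
Proof.
split; first split.
- by move=> F [/subfieldP[[F1 _ _] _] _].
- move=> a b Sa Sb F FS; have [/subfieldP[[_ FB _] _] _] := FS.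
  by apply: FB; [apply: Sa|apply: Sb].
- move=> a b Sa Sb F FS; have [/subfieldP[[_ _ FM] _] _] := FS.
  by apply: FM; [apply: Sa|apply: Sb].
- move=> a Sa F FS; have [/subfieldP[_ FV] _] := FS.
  by apply: FV; apply: Sa.
Qed.

Lemma field_gen_gen (S : set C) a : S a -> field_gen S a.
Proof. by move=> Sa F [_ SF]; apply: SF. Qed.

Lemma field_gen_sub (S F : set C) : is_subfield F -> S `<=` F ->
  field_gen S `<=` F.
Proof. by move=> /subfieldP sF SF a; apply. Qed.

Lemma Qsqrt_opp_subfield d : is_subfield (Qsqrt_opp K d).
Proof. exact: subfield_field_gen. Qed.

Lemma Qsqrt_opp_sqrtN d : Qsqrt_opp K d (sqrtN K d).
Proof. exact: field_gen_gen. Qed.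

Arguments Qsqrt_opp_sqrtN : clear implicits.

Lemma integral_subring : is_subring [set z | integralOver (intr : int -> C) z].
Proof.
split=> [|a b|a b]; first exact: integral1.
  exact: integral_sub.
exact: integral_mul.
Qed.

Lemma O_opp_subring d : is_subring (O_opp K d).
Proof.
have [[F1 FB FM] _] := Qsqrt_opp_subfield d; have [I1 IB IM] := integral_subring.
split=> [//|a b [Fa Ia] [Fb Ib]|a b [Fa Ia] [Fb Ib]].
  by split; [apply: FB|apply: IB].
by split; [apply: FM|apply: IM].
Qed.

Lemma integral_quadratic (p q : int) z :
  z ^+ 2 = p%:~R * z + q%:~R -> integralOver (intr : int -> C) z.
Proof.
move=> z2; exists ('X ^+ 2 - (p%:P * 'X + q%:P)).
  rewrite monicE lead_coefDl ?lead_coefXn // size_polyN size_polyXn.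
  by rewrite size_MXaddC; case: ifP => // _; rewrite !ltnS size_polyC_leq1.
rewrite rmorphB rmorphD !rmorphM /= !map_polyX !map_polyC /= rootE !hornerE.
by rewrite -expr2 z2 subrr.
Qed.

Lemma O_opp_sqrtN d : O_opp K d (sqrtN K d).
Proof.
split; first exact: Qsqrt_opp_sqrtN.
apply: (@integral_quadratic 0 (- d%:Z)).
by rewrite sqr_sqrtN mul0r add0r rmorphN.
Qed.

End Subrings.

Arguments Qsqrt_opp_sqrtN : clear implicits.

(** * Integers of the imaginary quadratic fields of discriminant -4, -8 and -3 *)

Section QuadraticIntegers.
Variable K : realType.
Local Notation C := K[i].
Implicit Types (R F : set C) (a b z : C).

(** The integers are integrally closed; the algebraic numbers serve only to
transport this fact to the complex numbers at hand. *)
Lemma integral_ratr (q : rat) : integralOver (intr : int -> C) (ratr q) ->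
  exists m : int, q = m%:~R.
Proof.
case=> p mp; have -> : map_poly (intr : int -> C) p =
    map_poly (ratr : rat -> C) (map_poly intr p).
  by rewrite -map_poly_comp; apply: eq_map_poly => m; rewrite /= ratr_int.
rewrite fmorph_root => rq.
have /Cint_rat_Aint : (ratr q : algC) \in Crat by apply: Crat_rat.
case/(_ _)/intrP=> [|m].
  apply: (@root_monic_Aint (map_poly intr p)).
  - have -> : map_poly (intr : int -> algC) p =
        map_poly (ratr : rat -> algC) (map_poly intr p).
      by rewrite -map_poly_comp; apply: eq_map_poly => m; rewrite /= ratr_int.
    by rewrite fmorph_root.
  - by apply: monic_map.
  - by apply/polyOverP => i; rewrite coef_map /= rpred_int.
rewrite -(ratr_int algC) => /fmorph_inj E.
by exists m.
Qed.

Lemma rat_sqr_int (q : rat) (m : int) : q ^+ 2 = m%:~R -> exists n : int, q = n%:~R.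
Proof.
move=> q2; apply: integral_ratr; apply: (@integral_quadratic K 0 m).
by rewrite mul0r add0r -rmorphXn /= q2 ratr_int.
Qed.

Lemma integral_conj z : integralOver (intr : int -> C) z ->
  integralOver (intr : int -> C) (conjc z).
Proof.
case=> p mp pz; exists p => //.
have -> : map_poly (intr : int -> C) p =
    map_poly (conjc : C -> C) (map_poly intr p).
  by rewrite -map_poly_comp; apply: eq_map_poly => m; rewrite /= rmorph_int.
by rewrite fmorph_root.
Qed.

Lemma Qsqrt_oppP d z : (0 < d)%N -> Qsqrt_opp K d z ->
  exists x y : rat, z = ratr x + ratr y * sqrtN K d.
Proof.
move=> d0; apply: (field_gen_sub (F :=
  [set z | exists x y : rat, z = ratr x + ratr y * sqrtN K d])) => [|_ ->].
  have t2 := sqr_sqrtN K d; move: (sqrtN K d) t2 => t t2.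
  split; first split.
  - by exists 1, 0; rewrite rmorph1 rmorph0 mul0r addr0.
  - move=> _ _ [x [y ->]] [x' [y' ->]]; exists (x - x'), (y - y').
    by rewrite !rmorphB /=; ring.
  - move=> _ _ [x [y ->]] [x' [y' ->]].
    exists (x * x' - d%:R * (y * y')), (x * y' + y * x').
    rewrite !(rmorphB, rmorphD, rmorphM) /= !rmorph_nat.
    by ring: t2.
  - move=> _ [x [y ->]].
    have [z0|z0] := eqVneq (ratr x + ratr y * t) 0.
      by exists 0, 0; rewrite z0 invr0 rmorph0 mul0r addr0.
    pose N : rat := x ^+ 2 + d%:R * y ^+ 2.
    have zN : (ratr x + ratr y * t) * (ratr x - ratr y * t) = ratr N.
      by rewrite /N !(rmorphD, rmorphM, rmorphXn) /= rmorph_nat; ring: t2.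
    have N0 : N != 0.
      apply: contra_neq z0 => N0; have [/eqP x0 /eqP y0] : x == 0 /\ y == 0.
        have d0' : 0 < d%:R :> rat by rewrite ltr0n.
        have x2 := sqr_ge0 x; have y2 := sqr_ge0 y.
        have dy2 : 0 <= d%:R * y ^+ 2 by apply: mulr_ge0 => //; apply: ltW.
        have [/eqP] : x ^+ 2 = 0 /\ d%:R * y ^+ 2 = 0.
          by rewrite /N in N0; split; lra.
        by rewrite sqrf_eq0 => -> /eqP; rewrite mulf_eq0 gt_eqF //= sqrf_eq0.
      by rewrite x0 y0 rmorph0 mul0r addr0.
    exists (x / N), (- y / N); apply: (mulfI z0); rewrite mulfV //.
    have N0' : ratr N != 0 :> C by rewrite fmorph_eq0.
    rewrite !fmorph_div rmorphN /=; apply: (mulIf N0').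
    by rewrite mul1r -[LHS]zN; move: (ratr N) N0' => n n0; field.
by exists 0, 1; rewrite rmorph0 rmorph1 mul1r add0r.
Qed.

(** The trace 2x and the norm x^2 + dy^2 of a quadratic integer are rational
and integral, hence integers. *)
Lemma O_oppP d z : (0 < d)%N -> O_opp K d z ->
  exists (x y : rat) (m n : int), [/\ z = ratr x + ratr y * sqrtN K d,
    2 * x = m%:~R & x ^+ 2 + d%:R * y ^+ 2 = n%:~R].
Proof.
move=> d0 [/(Qsqrt_oppP d0)[x [y zE]] zI].
have zJE : conjc z = ratr x - ratr y * sqrtN K d.
  have conjDM a b c : conjc (a + b * c) = conjc a + conjc b * conjc c :> C.
    by rewrite rmorphD rmorphM.
  rewrite zE conjDM conj_sqrtN mulrN.
  by congr (_ - _ * _); apply: fmorph_rat.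
have zJ := integral_conj zI.
have [|m Em] := @integral_ratr (2 * x).
  have := integral_add zI zJ; rewrite zJE zE.
  by congr integralOver; rewrite rmorphM /= rmorph_nat; ring.
have [|n En] := @integral_ratr (x ^+ 2 + d%:R * y ^+ 2).
  have := integral_mul zI zJ; rewrite zJE zE.
  congr integralOver; rewrite !(rmorphD, rmorphM, rmorphXn) /= rmorph_nat.
  by have := sqr_sqrtN K d; move: (sqrtN K d) => t t2; ring: t2.
by exists x, y, m, n.
Qed.

Lemma int_parity (m : int) : exists k : int, m = 2 * k \/ m = 2 * k + 1.
Proof.
exists (m %/ 2)%Z; have := divz_eq m 2; have := ltz_pmod m (ltr0Sn _ 1).
by have := modz_ge0 m (d := 2) isT; lia.
Qed.

(** Write x = m / 2 and y = n / 2: the norm gives m^2 + n^2 = 4N, and reduction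
modulo 4 forces m and n to be even. *)
Lemma O_opp1_sub z : O_opp K 1 z -> exists a b : int,
  z = a%:~R + b%:~R * sqrtN K 1.
Proof.
case/O_oppP=> // x [y [m [N [-> xm xyN]]]].
have [|n ym] := @rat_sqr_int (2 * y) (4 * N - m ^+ 2).
  by rewrite rmorphB /= intrM rmorphXn /= -xm -xyN; ring.
have mn : m ^+ 2 + n ^+ 2 = 4 * N.
  apply/eqP; rewrite -(eqr_int rat) rmorphD /= intrM !rmorphXn /= -xm -ym -xyN.
  by apply/eqP; ring.
have [a ma] := int_parity m; have [b nb] := int_parity n.
have [ma' nb'] : m = 2 * a /\ n = 2 * b.
  by case: ma nb mn => -> [] -> mn; split; lia.
exists a, b; rewrite -!(ratr_int C); congr (ratr _ + ratr _ * _).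
  by apply: (mulfI (_ : 2 != 0 :> rat)) => //; rewrite xm ma' intrM.
by apply: (mulfI (_ : 2 != 0 :> rat)) => //; rewrite ym nb' intrM.
Qed.
(** Writing x = m / 2 and y = n / 4 turns the norm into the equation
n^2 = 2 (4N - m^2), whose reductions modulo powers of 2 force 2 to
divide m and 4 to divide n. *)
Lemma O_opp2_sub z : O_opp K 2 z -> exists a b : int,
  z = a%:~R + b%:~R * sqrtN K 2.
Proof.
case/O_oppP=> // x [y [m [N [-> xm xyN]]]].
have [|n ym] := @rat_sqr_int (4 * y) (2 * (4 * N - m ^+ 2)).
  by rewrite intrM rmorphB /= intrM rmorphXn /= -xm -xyN; ring.
have mn : n ^+ 2 = 2 * (4 * N - m ^+ 2).
  apply/eqP; rewrite -(eqr_int rat) intrM rmorphB /= intrM !rmorphXn /=.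
  by rewrite -xm -ym -xyN; apply/eqP; ring.
have [a ma] := int_parity m; have [b nb] := int_parity n.
have [c bc] := int_parity b.
have [ma' nb'] : m = 2 * a /\ n = 4 * c.
  by case: ma nb bc mn => -> [] -> [] -> mn; split; lia.
exists a, c; rewrite -!(ratr_int C); congr (ratr _ + ratr _ * _).
  by apply: (mulfI (_ : 2 != 0 :> rat)) => //; rewrite xm ma' intrM.
by apply: (mulfI (_ : 4 != 0 :> rat)) => //; rewrite ym nb' intrM.
Qed.

(** Clearing denominators by y = n / 6 gives n^2 = 3 (4N - m^2). So 3 divides n,
and then m and n / 3 have the same parity. *)
Lemma O_opp3_sub z : O_opp K 3 z -> exists a b : int,
  z = a%:~R + b%:~R * ((1 + sqrtN K 3) / 2).
Proof.
case/O_oppP=> // x [y [m [N [-> xm xyN]]]].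
have [|n ym] := @rat_sqr_int (6 * y) (3 * (4 * N - m ^+ 2)).
  by rewrite intrM rmorphB /= intrM rmorphXn /= -xm -xyN; ring.
have mn : n ^+ 2 = 3 * (4 * N - m ^+ 2).
  apply/eqP; rewrite -(eqr_int rat) intrM rmorphB /= intrM !rmorphXn /=.
  by rewrite -xm -ym -xyN; apply/eqP; ring.
have [k nk] : exists k : int, n = 3 * k.
  have [k [nk|[nk|nk]]] : exists k : int,
      n = 3 * k \/ n = 3 * k + 1 \/ n = 3 * k + 2.
    exists (n %/ 3)%Z; have := divz_eq n 3; have := ltz_pmod n (ltr0Sn _ 2).
    by have := modz_ge0 n (d := 3) isT; lia.
  - by exists k.
  - by move: mn; rewrite nk => mn; exfalso; lia.
  - by move: mn; rewrite nk => mn; exfalso; lia.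
have mk : 3 * k ^+ 2 = 4 * N - m ^+ 2 by rewrite nk in mn; lia.
have [a mka] : exists a : int, m = k + 2 * a.
  have [a ma] := int_parity m; have [b kb] := int_parity k.
  by exists (a - b); case: ma kb mk => -> [] -> mk; lia.
have xE : x = a%:~R + k%:~R / 2.
  apply: (mulfI (_ : 2 != 0 :> rat)) => //.
  by rewrite xm mka rmorphD /= intrM; field.
have yE : y = k%:~R / 2.
  by apply: (mulfI (_ : 6 != 0 :> rat)) => //; rewrite ym nk intrM; field.
exists a, k; rewrite xE yE rmorphD fmorph_div /= !ratr_int rmorph_nat.
by field.
Qed.

Lemma O_opp3_pi3 : O_opp K 3 (expi (pi / 3)).
Proof.
have [sQ QV] := Qsqrt_opp_subfield K 3; split; last first.
  apply: (@integral_quadratic K 1 (-1)).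
  by rewrite expi_pi3 rmorphN rmorph1 mul1r.
rewrite expi_pi3E; apply: (subringM sQ); last by apply: QV; exact (subring_int 2 sQ).
by apply: (subringD sQ) (Qsqrt_opp_sqrtN K 3); exact (subring_int 1 sQ).
Qed.

Lemma O_opp3_2pi3 : O_opp K 3 (expi (2 * pi / 3)).
Proof.
have sO := O_opp_subring K 3; rewrite expi_2pi3.
by have [O1 OB _] := sO; apply: OB => //; apply: O_opp3_pi3.
Qed.

End QuadraticIntegers.

(** * Endomorphism rings of elliptic curves *)

Section EllipticEnd.
Variable K : realType.
Local Notation C := K[i].
Variable R : set C.
Hypothesis ellR : is_elliptic_End R.
Implicit Types (a b z : C).

(** All the arithmetic of R below is read off from the integer coordinates of
a w1 and a w2 in the basis of the lattice. *)
Lemma elliptic_action : exists w1 w2 : C, real_indep w1 w2 /\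
  forall a, R a -> exists m n p q : int,
    a * w1 = m%:~R * w1 + n%:~R * w2 /\ a * w2 = p%:~R * w1 + q%:~R * w2.
Proof.
have [w1 [w2 [ind ->]]] := ellR; exists w1, w2; split=> // a /= Ra.
have [|m [n E1]] := Ra w1; first by exists 1, 0; rewrite mul1r mul0r addr0.
have [|p [q E2]] := Ra w2; first by exists 0, 1; rewrite mul1r mul0r add0r.
by exists m, n, p, q.
Qed.

Lemma real_indep_neq0 (w1 w2 : C) : real_indep w1 w2 -> w1 != 0.
Proof.
move=> ind; apply/eqP => w0; have [|] := ind 1 0.
  by rewrite w0 mulr0 mul0r addr0.
by move/eqP; rewrite oner_eq0.
Qed.

Lemma elliptic_subring : is_subring R.
Proof.
have [w1 [w2 [_ ->]]] := ellR; split=> [z|a b Ra Rb z Lz|a b Ra Rb z Lz] /=.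
- by rewrite mul1r.
- have [m [n E1]] := Ra z Lz; have [p [q E2]] := Rb z Lz.
  exists (m - p), (n - q); rewrite mulrBl E1 E2 !rmorphB /=.
  by move: (m%:~R : C) (n%:~R : C) (p%:~R : C) (q%:~R : C) => *; ring.
- by rewrite -mulrA; apply/Ra/Rb.
Qed.

(** A real a maps w1 to a real multiple of itself, so by independence the
coordinate of a w1 along w2 vanishes. *)
Lemma elliptic_real_int (x : K) : R x%:C -> exists m : int, x = m%:~R.
Proof.
have [w1 [w2 [ind act]]] := elliptic_action.
case/act=> m [n [_ [_ [E _]]]]; exists m; apply/eqP; rewrite -subr_eq0.
have [|-> //] := ind (x - m%:~R) (- n%:~R).
by rewrite rmorphB rmorphN /= !rmorph_int mulrBl E mulNr; ring.
Qed.

(** An element of R is an eigenvalue of the integer matrix by which it acts on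
the lattice, and p and -q are the trace and the determinant of this matrix. *)
Lemma elliptic_quadratic a : R a -> exists p q : int,
  a ^+ 2 = p%:~R * a + q%:~R.
Proof.
have [w1 [w2 [ind act]]] := elliptic_action; have w0 := real_indep_neq0 ind.
case/act=> m [n [p [q [E1 E2]]]]; exists (m + q), (n * p - m * q).
apply: (mulIf w0); rewrite rmorphD rmorphB /= !intrM.
move: (m%:~R : C) (n%:~R : C) (p%:~R : C) (q%:~R : C) E1 E2 => M N P Q E1 E2.
have e1 : (a - M) * w1 = N * w2 by rewrite mulrBl E1; ring.
have e2 : (a - Q) * w2 = P * w1 by rewrite mulrBl E2; ring.
have : (a - Q) * ((a - M) * w1) = N * (P * w1) by rewrite e1 -e2; ring.
move=> e; transitivity ((a - Q) * ((a - M) * w1) + ((M + Q) * a - M * Q) * w1).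
  by ring.
by rewrite e; ring.
Qed.

(** Eliminate w2 between the expressions of a w1 and t w1. The coefficient q is
the coordinate of t w1 along w2, nonzero because t is not real. *)
Lemma elliptic_rank2 a t : R a -> R t -> (forall x : K, t <> x%:C) ->
  exists p q r : int, (q%:~R != 0 :> C) /\ q%:~R * a = p%:~R + r%:~R * t.
Proof.
have [w1 [w2 [ind act]]] := elliptic_action; have w0 := real_indep_neq0 ind.
move=> /act[m [n [_ [_ [E1 _]]]]] /act[p [q [_ [_ [E2 _]]]]] nr.
exists (q * m - n * p), q, n; split.
  apply/negP => /eqP q0; apply: (nr p%:~R); rewrite rmorph_int.
  by apply: (mulIf w0); rewrite E2 q0 mul0r addr0.
apply: (mulIf w0); rewrite rmorphB /= !intrM -mulrA E1 mulrDl -mulrA E2.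
by ring.
Qed.

(** R lies in the field generated by any of its non-real elements, by
elliptic_rank2, and consists of integral elements, by elliptic_quadratic. *)
Lemma elliptic_sub_O_opp d : (0 < d)%N -> R (sqrtN K d) -> R `<=` O_opp K d.
Proof.
move=> d0 Rt a Ra; have [sQ QV] := Qsqrt_opp_subfield K d; split; last first.
  by have [p [q a2]] := elliptic_quadratic Ra; apply: integral_quadratic a2.
have [|p [q [r [q0 E]]]] := elliptic_rank2 Ra Rt.
  move=> x [_ /eqP]; rewrite sqrtr_eq0 leNgt ltr0n d0 //.
have -> : a = (p%:~R + r%:~R * sqrtN K d) * (q%:~R)^-1.
  by rewrite -E mulrAC mulfV // mul1r.
apply: (subringM sQ); last by apply: QV; exact (subring_int q sQ).
apply: (subringD sQ); first exact (subring_int p sQ).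
exact (subringM sQ (subring_int r sQ) (Qsqrt_opp_sqrtN K d)).
Qed.

(** R is squeezed between the order generated by sqrt(-2) and the integers of
the field, which coincide. *)
Lemma elliptic_O_opp2 : R (sqrtN K 2) -> R = O_opp K 2.
Proof.
move=> Rt; have sR := elliptic_subring.
apply/seteqP; split; first exact: elliptic_sub_O_opp.
move=> _ /O_opp2_sub[a [b ->]].
by apply: subringD => //; [|apply: subringM => //]; apply: subring_int.
Qed.

Lemma elliptic_O_opp3 : R ((1 + sqrtN K 3) / 2) -> R = O_opp K 3.
Proof.
move=> Rz; have sR := elliptic_subring.
apply/seteqP; split.
  apply: elliptic_sub_O_opp => //.
  have -> : sqrtN K 3 = 2%:~R * ((1 + sqrtN K 3) / 2) - 1%:~R by field.
  by case: (sR) => _ RB _; apply: RB; [apply: subringM|]; rewrite //; apply: subring_int.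
move=> _ /O_opp3_sub[a [b ->]].
by apply: subringD => //; [|apply: subringM => //]; apply: subring_int.
Qed.

Lemma O_opp1_Zi : O_opp K 1 = Zi K.
Proof.
apply/seteqP; split=> [_ /O_opp1_sub[a [b ->]]|_ [a [b ->]]].
  by exists a, b; rewrite sqrtN_i.
have sO := O_opp_subring K 1; rewrite -sqrtN_i.
apply: subringD => //; first exact: subring_int.
by apply: subringM; [|apply: subring_int|apply: O_opp_sqrtN].
Qed.

Lemma R_opp1_Zi : R_opp K 1 1 = Zi K.
Proof.
rewrite -O_opp1_Zi; have sO := O_opp_subring K 1; apply/seteqP; split.
  move=> _ [a [w [Ow ->]]]; rewrite mul1r.
  by apply: subringD => //; apply: subring_int.
by move=> w Ow; exists 0, w; rewrite mul1r add0r.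
Qed.

Lemma elliptic_Zi : R 'i%R -> R = Zi K.
Proof.
rewrite -sqrtN_i => Rt; have sR := elliptic_subring; rewrite -O_opp1_Zi.
apply/seteqP; split; first exact: elliptic_sub_O_opp.
move=> _ /O_opp1_sub[a [b ->]].
by apply: subringD => //; [|apply: subringM => //]; apply: subring_int.
Qed.

(** If R contained two square roots of -p and -q, their product, whose square
is the positive integer pq, would be real, hence an integer. *)
Lemma elliptic_sqr_mul a b (p q : nat) : R a -> R b ->
  a ^+ 2 = - p%:R -> b ^+ 2 = - q%:R -> exists m : int, m ^+ 2 = (p * q)%N.
Proof.
move=> Ra Rb a2 b2; have Rab := subringM elliptic_subring Ra Rb.
have ab2 : (a * b) ^+ 2 = (p * q)%:R by rewrite exprMn a2 b2 mulrNN natrM.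
have [x abx] : exists x : K, a * b = x%:C.
  pose s : K := Num.sqrt (p * q)%:R.
  have : (a * b) ^+ 2 = s%:C ^+ 2.
    by rewrite -rmorphXn sqr_sqrtr ?ler0n // rmorph_nat.
  move/eqP; rewrite eqf_sqr => /orP[]/eqP->; first by exists s.
  by exists (- s); rewrite rmorphN.
rewrite abx in Rab ab2; have [m xm] := elliptic_real_int Rab; exists m.
apply/eqP; rewrite -(eqr_int C) rmorphXn /= -[(_ : nat)%:~R]/((p * q)%:R).
by rewrite -ab2 xm rmorph_int.
Qed.

(** Let a be a root of unity in R that is not real. Its conjugate is the other
root of its integer quadratic equation, so t = a + conj(a) is an integer and
a^2 = t a - 1. As |t| < 2, t is 0, 1 or -1 and a has order 4, 6 or 3. *)
Lemma elliptic_root_of_unity a n : (0 < n)%N -> R a -> a ^+ n = 1 ->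
  a ^+ 4 = 1 \/ a ^+ 6 = 1.
Proof.
move=> n0 Ra an.
have ac : a * conjc a = 1.
  rewrite -sqr_normc; have /eqP : `|a| ^+ n = 1 by rewrite -normrX an normr1.
  by rewrite pexpr_eq1 // => /eqP->; rewrite expr1n.
have [ca|nca] := eqVneq (conjc a) a.
  by left; rewrite -[4%N]/(2 * 2)%N exprM (_ : a ^+ 2 = 1) ?expr1n // expr2 -{1}ca mulrC.
have [p [q a2]] := elliptic_quadratic Ra.
have c2 : conjc a ^+ 2 = p%:~R * conjc a + q%:~R.
  by rewrite -rmorphXn /= a2 rmorphD rmorphM /= !rmorph_int.
have acp : a + conjc a = p%:~R.
  apply: (mulIf (_ : a - conjc a != 0)); first by rewrite subr_eq0 eq_sym.
  transitivity (a ^+ 2 - conjc a ^+ 2); first by ring.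
  by rewrite a2 c2; ring.
have {}a2 : a ^+ 2 = p%:~R * a - 1 by rewrite -acp -ac; ring.
have : (p = 0) \/ (p = 1) \/ (p = -1).
  have p4 : (p%:~R : K) ^+ 2 < 4.
    move: ac acp nca; case: a {Ra an a2 c2} => x y; rewrite /=.
    move=> /(congr1 (@complex.Re K)) /= ac /(congr1 (@complex.Re K)) /=.
    have -> : complex.Re (p%:~R : C) = p%:~R.
      by rewrite -(rmorph_int (real_complex K)).
    move=> <-; rewrite eq_complex /= eqxx /= => yy.
    have y0 : y != 0 by apply: contra yy => /eqP->; rewrite oppr0.
    have : 0 < y ^+ 2 by rewrite lt_def sqr_ge0 sqrf_eq0 y0.
    by move: ac; rewrite !expr2; nra.
  have : p ^+ 2 < 4 by rewrite -(ltr_int K) rmorphXn.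
  by nia.
case=> [p0|[p1|p1]]; rewrite ?p0 ?p1 in a2.
- by left; rewrite -[4%N]/(2 * 2)%N exprM a2; ring.
- by right; rewrite rmorph1 mul1r in a2; ring: a2.
- by right; rewrite rmorphN rmorph1 mulN1r in a2; ring: a2.
Qed.

Lemma int_sqr_neq (n k : nat) (m : int) :
  (n ^ 2 < k < n.+1 ^ 2)%N -> m ^+ 2 <> k.
Proof.
move=> nk /(congr1 absz); rewrite abszX => mk; move: nk.
rewrite -[k]/(`|k%:Z|%N) -mk !ltn_sqr => /andP[nm mn].
by have := leq_trans mn nm; rewrite ltnn.
Qed.

End EllipticEnd.

(** * Subgroups of GL(2, R) and elements of order 4 *)

Section GL2Groups.
Variable K : realType.
Local Notation C := K[i].
Implicit Types (R F : set C) (g h x : 'M[C]_2).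

(** The inverse of a 2 x 2 matrix is its adjugate times the inverse of its
determinant, which lies in R by definition of GL(2, R). *)
Lemma GL2_subgroup R : is_subring R -> is_subgroup (GL2 R).
Proof.
move=> sR; have [R1 _ _] := sR; apply: subgroup_intro.
- move=> g [_ [u _ gu]]; rewrite -[_ \is a _]/(g \in unitmx) unitmxE unitfE.
  by apply: contra_eqN gu => /eqP->; rewrite mul0r eq_sym oner_eq0.
- split=> [i j|]; last by exists 1; rewrite ?det1 ?mulr1.
  rewrite mxE; case: (_ == _); last exact: subring0.
  by [].
- move=> g h [Rg [u Ru gu]] [Rh [v Rv hv]]; split=> [i j|].
    rewrite mxE !big_ord_recl big_ord0 addr0.
    by apply: subringD => //; apply: subringM.
  exists (u * v); first exact: subringM.
  by rewrite detM mulrACA gu hv mulr1.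
move=> g [Rg [u Ru gu]].
have gE := mx2_eta g; set a := g 0 0 in gE; set b := g 0 1 in gE.
set c := g 1 0 in gE; set d := g 1 1 in gE.
have -> : g^-1 = mx2 (u * d) (u * - b) (u * - c) (u * a).
  have E : g * mx2 (u * d) (u * - b) (u * - c) (u * a) = 1.
    rewrite gE mx2M -[1]/(1%:M) scalar_mx2 -gu [g in \det g]gE det_mx2.
    by apply: eq_mx2; rewrite !mxE /=; ring.
  have gU : g \is a GRing.unit by have [] := mulmx1_unit E.
  by rewrite -[RHS](mulKr gU) E mulr1.
split; last first.
  have Dg : \det g = a * d - b * c by rewrite gE det_mx2.
  exists (\det g); last first.
    rewrite det_mx2; transitivity ((\det g * u) ^+ 2); first by rewrite Dg; ring.
    by rewrite gu expr1n.
  rewrite Dg; apply: subringD => //; first by apply: subringM => //; apply: Rg.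
  by apply: subringN => //; apply: subringM => //; apply: Rg.
by move=> i j; rewrite mxE; do !case: (_ == _); apply: subringM => //;
  rewrite ?/a ?/b ?/c ?/d //; apply: subringN.
Qed.

Lemma GL2_det_neq0 R g : GL2 R g -> \det g != 0.
Proof.
case=> _ [u _ gu].
by apply: contra_eqN gu => /eqP->; rewrite mul0r eq_sym oner_eq0.
Qed.

Lemma GL2_unit R g : GL2 R g -> g \is a GRing.unit.
Proof. by move=> /GL2_det_neq0; rewrite -unitfE -unitmxE. Qed.

Lemma GL2_mx2 R a b c d u : R a -> R b -> R c -> R d -> R u ->
  (a * d - b * c) * u = 1 -> GL2 R (mx2 a b c d).
Proof.
move=> Ra Rb Rc Rd Ru E; split; last by exists u; rewrite ?det_mx2.
by move=> i j; rewrite mxE; do !case: (_ == _).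
Qed.

Lemma GL2_det R g : is_subring R -> GL2 R g -> R (\det g).
Proof.
move=> sR [Rg _]; rewrite [g]mx2_eta det_mx2.
by apply: (subringD sR); [|apply: (subringN sR)]; apply: (subringM sR).
Qed.

Lemma GL2_tr R g : is_subring R -> GL2 R g -> R (\tr g).
Proof. by move=> sR [Rg _]; rewrite [g]mx2_eta tr_mx2; apply: (subringD sR). Qed.

Lemma mxN1_neq1 : (-1 : 'M[C]_2) != 1.
Proof.
apply/eqP => E; have : -1 = 1 :> C by apply: scalar_mx2_inj; rewrite -mxN1.
by apply/eqP/N1_neq1.
Qed.

Lemma prim4_sqrN1 g : g ^+ 2 = -1 -> 4.-primitive_root g.
Proof.
move=> g2; have g4 : g ^+ 4 = 1 by rewrite -[4%N]/(2 * 2)%N exprM g2 sqrrN expr1n.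
have [m pm m4] := prim_order_exists (isT : 0 < 4)%N g4.
suff /negP m2 : ~~ (m %| 2)%N.
  have : (m \in divisors 4) by rewrite -dvdn_divisors.
  by rewrite !inE => /or3P[] /eqP mE; move: m2; rewrite mE in pm *.
by rewrite (prim_order_dvd pm) g2 mxN1_neq1.
Qed.

(** The square of g is an involution of determinant 1, hence a scalar 1 or -1 by
scalar_or_tr0, and g has order 4; the trace of g vanishes by the same lemma,
since a scalar with square -1 has determinant -1. *)
Lemma SL2_prim4 g : \det g = 1 -> 4.-primitive_root g ->
  g ^+ 2 = -1 /\ \tr g = 0.
Proof.
move=> dg pg.
have g2 : g ^+ 2 = -1.
  have g4 : (g ^+ 2) ^+ 2 = 1%:M by rewrite -exprM (prim_expr_order pg).
  case: (scalar_or_tr0 g4) => [/sqr_tr0|[a Ea]].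
    rewrite g4 detX dg expr1n => /scalar_mx2_inj/esym/eqP.
    by rewrite (negPf (N1_neq1 K)).
  have /eqP : a ^+ 2 = 1 by apply: scalar_mx2_inj; rewrite rmorphXn /= -Ea.
  rewrite sqrf_eq1 => /orP[]/eqP a1; last by rewrite Ea a1 -mxN1.
  have := prim_order_dvd pg 2; rewrite Ea a1 -[1%:M]/(1 : 'M_2) eqxx.
  by [].
split=> //; have := g2; rewrite mxN1 => /scalar_or_tr0[//|[a Ea]].
have : a ^+ 2 = -1 by apply: scalar_mx2_inj; rewrite rmorphXn /= -Ea g2 mxN1.
have : \det g = a ^+ 2 by rewrite Ea scalar_mx2 det_mx2 mulr0 subr0 expr2.
by rewrite dg => <- /eqP; rewrite eq_sym (negPf (N1_neq1 K)).
Qed.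

Lemma tr0_SL2_prim4 g : \det g = 1 -> \tr g = 0 -> 4.-primitive_root g.
Proof.
by move=> dg /sqr_tr0 g2; apply: prim4_sqrN1; rewrite g2 dg -mxN1.
Qed.

(** The determinant separates the powers of h from the subgroup generated by
an element of determinant 1. *)
Lemma det_cycle n s g h b : n.-primitive_root g -> \det g = 1 ->
  s.-primitive_root (\det h) -> cycle_of g (h ^+ b) -> (s %| b)%N.
Proof.
move=> pg dg ph; rewrite (cycle_ofE pg) => -[k _ E].
by rewrite (prim_order_dvd ph) -detX E detX dg expr1n.
Qed.

Lemma inverting_intro g h : g ^+ 2 = -1 -> h \is a GRing.unit ->
  h * g = - (g * h) -> h * g * h^-1 = g^-1.
Proof.
move=> g2 hU ->; have gU := prim_root_unit (prim4_sqrN1 g2).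
rewrite mulNr mulrK //; apply: (mulIr gU).
by rewrite mulVr // mulNr -expr2 g2 opprK.
Qed.

End GL2Groups.

(** * Isomorphism types of the non-abelian groups *)

Section InvertingPresentations.
Local Open Scope group_scope.

Lemma isog_Grp_relator (gT : finGroupType) (G : {group gT}) (n s : nat) :
    G \isog Grp (g : h : g ^+ n, h ^+ s = g ^+ n, h * g * h^-1 = g^-1) ->
  G \isog Grp (g : h : g ^+ n, h ^+ s, h * g * h^-1 = g^-1).
Proof.
move=> isoG rT K; rewrite isoG.
apply/existsP/existsP=> -[[x y] /eqP[defK xn ys yx]]; exists (x, y).
  by rewrite /= !xpair_eqE /= defK xn ys yx xn !eqxx.
by rewrite /= !xpair_eqE /= defK xn ys yx !eqxx.
Qed.

Lemma conjg_inverting (gT : finGroupType) (x y : gT) :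
  (y * x * y^-1 = x^-1) <-> (x ^ y = x^-1).
Proof.
have -> : y * x * y^-1 = x ^ y^-1 by rewrite conjgE invgK mulgA.
split=> E; apply: invg_inj; rewrite invgK -conjVg -E -conjgM.
  by rewrite mulVg conjg1.
by rewrite mulgV conjg1.
Qed.

(** Each of the two groups satisfies the relations that present the other one,
so each is a homomorphic image of the other. *)
Lemma isog_dihedral8 (gT : finGroupType) (G : {group gT}) :
    G \isog Grp (g : h : g ^+ 4, h ^+ 2, h * g * h^-1 = g^-1) ->
  [set: gsort (dihedral_gtype 8)]%G \isog G.
Proof.
move=> isoG; have isoD := @Grp_dihedral 4 isT.
rewrite isogEhom isoG isoD; apply/andP; split.
  case/existsP: (isoGrp_hom isoD) => -[x y] /eqP[defK xn ys yx].
  apply/existsP; exists (x, y); rewrite /= !xpair_eqE /= defK xn ys.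
  by rewrite (conjg_inverting x y).2 ?eqxx.
case/existsP: (isoGrp_hom isoG) => -[x y] /eqP[defK xn ys yx].
apply/existsP; exists (x, y); rewrite /= !xpair_eqE /= defK xn ys.
by rewrite (conjg_inverting x y).1 ?eqxx.
Qed.

End InvertingPresentations.

Section Types.
Variable K : realType.
Local Notation C := K[i].
Implicit Types (R F : set C) (g h x : 'M[C]_2).

Lemma inverting_comm g h : 4.-primitive_root g -> h \is a GRing.unit ->
  h * g * h^-1 = g^-1 -> h * g = g ^+ 3 * h.
Proof.
move=> pg hU hg.
have -> : g ^+ 3 = g^-1 by rewrite (prim_root_invE pg).
by rewrite -hg divrK.
Qed.

(** Whatever the ambient ring, the isomorphism type of a group generated by g
and an element h inverting g depends only on the order s of the determinant
of h and on the position of h^s in the group generated by g. *)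
Lemma inverting_prods s k g h :
    4.-primitive_root g -> \det g = 1 -> s.-primitive_root (\det h) ->
    h ^+ s = g ^+ k -> h * g * h^-1 = g^-1 ->
  [/\ is_subgroup (prods g h), gen [set g; h] = prods g h &
    exists (gT : finGroupType) (G : {group gT}),
    [/\ isom_fin G (prods g h), #|G| = (4 * s)%N &
      (G \isog Grp (g : h : g ^+ 4, h ^+ s = g ^+ k, h * g * h^-1 = g^-1))%g]].
Proof.
move=> pg dg ph hs hg; have s0 := prim_order_gt0 ph.
have [m pm _] : {m | m.-primitive_root h & (m %| s * 4)%N}.
  apply: prim_order_exists; first by rewrite muln_gt0 s0.
  by rewrite exprM hs -exprM mulnC exprM (prim_expr_order pg) expr1n.
have hg' := inverting_comm pg (prim_root_unit pm) hg.
split; [exact: subgroup_prods pg pm hg'|exact: gen_prods pg pm hg'|].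
apply: (isom_fin_prods_inverting pg pm s0 hs hg) => b.
exact: (det_cycle pg dg ph).
Qed.

(** As g^-1 = -g, the matrices h and -h are conjugate under g. By sqr_tr0 the
square of h is then the scalar -det(h), so the order of h and its
eigenvalues are determined by its determinant. *)
Lemma inverting_tr0 g h : g ^+ 2 = -1 -> h \is a GRing.unit ->
  h * g * h^-1 = g^-1 -> \tr h = 0.
Proof.
move=> g2 hU hg.
have gU : g \is a GRing.unit by apply: prim_root_unit (prim4_sqrN1 g2).
have gV : g^-1 = - g.
  by apply: (mulIr gU); rewrite mulVr // mulNr -expr2 g2 opprK.
have E : h = - (g^-1 * (h * g)).
  have -> : h * g = g^-1 * h by rewrite -hg divrK.
  by rewrite gV mulrA mulrNN -expr2 g2 mulN1r opprK.
have : \tr h = - \tr h.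
  by rewrite {1}E raddfN /= tr_swap mulrK.
move/eqP; rewrite -subr_eq0 opprK -mulr2n mulrn_eq0 => /eqP.
by [].
Qed.

Lemma HC4_type3 g h : g ^+ 2 = -1 -> \det g = 1 -> \det h = -1 ->
  h ^+ 2 = 1 -> h * g * h^-1 = g^-1 -> HC4_type 3 (prods g h).
Proof.
move=> g2 dg dh h2 hg; have pg := prim4_sqrN1 g2.
have [||_ _ [gT [G [isoG _ GrpG]]]] := @inverting_prods 2 4 g h pg dg _ _ hg.
- by rewrite dh; exact: prim_N1.
- by rewrite h2 (prim_expr_order pg).
have GrpG' := isog_Grp_relator GrpG; split; last by exists gT, G.
exact: isom_fin_isog (isog_dihedral8 GrpG') isoG.
Qed.

Lemma HC4_type8 g h : g ^+ 2 = -1 -> \det g = 1 -> \det h = 'i%R ->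
  h ^+ 4 = -1 -> h * g * h^-1 = g^-1 -> HC4_type 8 (prods g h).
Proof.
move=> g2 dg dh h4 hg; have pg := prim4_sqrN1 g2.
have [||_ _ [gT [G [isoG oG GrpG]]]] := @inverting_prods 4 2 g h pg dg _ _ hg.
- by rewrite dh; exact: prim_i.
- by rewrite h4 g2.
by split; [have := isom_fin_card isoG; rewrite oG|exists gT, G].
Qed.

Lemma HC4_type9 g h : g ^+ 2 = -1 -> \det g = 1 -> 6.-primitive_root (\det h) ->
  h ^+ 6 = 1 -> h * g * h^-1 = g^-1 -> HC4_type 9 (prods g h).
Proof.
move=> g2 dg dh h6 hg; have pg := prim4_sqrN1 g2.
have [|_ _ [gT [G [isoG oG GrpG]]]] := @inverting_prods 6 4 g h pg dg dh _ hg.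
  by rewrite h6 (prim_expr_order pg).
have GrpG' := isog_Grp_relator GrpG.
by split; [have := isom_fin_card isoG; rewrite oG|exists gT, G].
Qed.

End Types.

(** * The groups of the list over a given ring *)

Section Groups.
Variable K : realType.
Local Notation C := K[i].
Implicit Types (R F : set C) (g h x : 'M[C]_2).

(** The determinant of h has the same order as h, so no nontrivial power of h has
determinant 1 and the product is direct. *)
Lemma commuting_prods n s g h : (1 < n)%N -> (1 < s)%N ->
    n.-primitive_root g -> \det g = 1 -> s.-primitive_root h ->
    s.-primitive_root (\det h) -> g * h = h * g ->
  [/\ is_subgroup (prods g h),
      internal_dprod (cycle_of g) (cycle_of h) (prods g h) &
      isom_fin (finset.setX (Zp n) (Zp s)) (prods g h)].
Proof.
move=> n1 s1 pg dg ph pd gh.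
have cap b : cycle_of g (h ^+ b) -> h ^+ b = 1.
  by move/(det_cycle pg dg pd); rewrite (prim_order_dvd ph) => /eqP.
split; [|exact: dprod_prods pg ph gh cap|exact: isom_fin_prods].
by apply: (subgroup_prods (j := 1) pg ph); rewrite expr1.
Qed.

(** Here tr(h^2) = tr(h)^2 - 2 det(h) = 0 and det(h^2) = 1, hence h^4 = -1. *)
Lemma HC4_1_intro R h : R = O_opp K 2 -> GL2 R h ->
  \det h = -1 -> \tr h = sqrtN K 2 -> HC4 1 R (cycle_of h).
Proof.
move=> RE Rh dh th; have sR : is_subring R by rewrite RE; apply: O_opp_subring.
have h4 : h ^+ 4 = -1.
  rewrite -[4%N]/(2 * 2)%N exprM sqr_tr0 ?detX ?dh ?sqrrN ?expr1n -?mxN1 //.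
  by rewrite tr_sqr dh th sqr_sqrtN; ring.
have ph : 8.-primitive_root h.
  apply: prim_root_primes => //; first by rewrite -[8%N]/(4 * 2)%N exprM h4 sqrrN expr1n.
  by rewrite /= h4 mxN1_neq1.
split.
- exact: subgroup_cycle (prim_root_unit ph).
- by apply: cycle_of_sub => //; apply: GL2_subgroup.
- split=> //; exists h => //; split=> //; first exact: finite_cycle_of ph.
  apply: eigenvalues_mx2; first by rewrite expi_pi4.
  by rewrite -expiD dh -expi_pi; congr expi; field.
- exact: isom_fin_cycle.
Qed.

Lemma HC4_2_intro R g h : R = Zi K -> SL2 R g -> 4.-primitive_root g ->
    GL2 R h -> h ^+ 2 = 1 -> \det h = -1 -> g * h = h * g ->
  HC4 2 R (prods g h).
Proof.
move=> RE [Rg dg] pg Rh h2 dh gh.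
have sR : is_subring R by rewrite RE; apply: Zi_subring.
have pd : 2.-primitive_root (\det h) by rewrite dh; apply: prim_N1.
have ph : 2.-primitive_root h.
  apply: prim_root_primes => //=; rewrite andbT expr1; apply/eqP => h1.
  by have /eqP := dh; rewrite h1 det1 eq_sym (negPf (N1_neq1 K)).
have [sP dP iP] := commuting_prods (isT : 1 < 4)%N (isT : 1 < 2)%N pg dg ph pd gh.
split=> //; first by apply: prods_sub => //; apply: GL2_subgroup.
split; first by exists 1%N; rewrite // R_opp1_Zi.
exists g, h; split=> //; first by split=> //; apply: has_order_prim.
split=> //; first exact: finite_cycle_of ph.
apply: eigenvalues_mx2; last by rewrite mulr1.
rewrite addrC subrr; case: (@scalar_or_tr0 _ h 1) => //= -[a ha].
have : a ^+ 2 = 1 by apply: scalar_mx2_inj; rewrite rmorphXn /= -ha.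
have : \det h = a ^+ 2 by rewrite ha scalar_mx2 det_mx2 mulr0 subr0 expr2.
by rewrite dh => <- /eqP; rewrite (negPf (N1_neq1 K)).
Qed.

Lemma HC4_3_intro R g h : is_subring R -> SL2 R g -> 4.-primitive_root g ->
    GL2 R h -> \det h = -1 -> h * g * h^-1 = g^-1 ->
  HC4 3 R (prods g h).
Proof.
move=> sR [Rg dg] pg Rh dh hg; have [g2 _] := SL2_prim4 dg pg.
have th := inverting_tr0 g2 (GL2_unit Rh) hg.
have h2 : h ^+ 2 = 1 by rewrite sqr_tr0 // dh opprK.
have pd : 2.-primitive_root (\det h) by rewrite dh; apply: prim_N1.
have h2' : h ^+ 2 = g ^+ 4 by rewrite h2 (prim_expr_order pg).
have [sP gP _] := inverting_prods pg dg pd h2' hg.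
split=> //; first by apply: prods_sub => //; apply: GL2_subgroup.
  exists g, h; split=> //; first by split=> //; apply: has_order_prim.
  split=> //; last by apply: eigenvalues_mx2; rewrite ?th ?dh ?mulr1 // addrC subrr.
  by have [m pm _] := prim_order_exists (isT : 0 < 2)%N h2; apply: finite_cycle_of pm.
exact: HC4_type3.
Qed.

(** The scalar matrix of a cube root of unity w has determinant w^2, again of
order 3, so it commutes with g and generates a complement. *)
Lemma HC4_5_intro R g : R = O_opp K 3 -> SL2 R g -> \tr g = 0 ->
  exists2 H, HC4 5 R H & HC4_5_of g H.
Proof.
move=> RE [Rg dg] tg; have sR : is_subring R by rewrite RE; apply: O_opp_subring.
have pg := tr0_SL2_prim4 dg tg.
have pw := prim_2pi3 K; set w := expi _ in pw.
have dw : \det (w%:M : 'M[C]_2) = w ^+ 2.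
  by rewrite scalar_mx2 det_mx2 mulr0 subr0 expr2.
have pd : 3.-primitive_root (\det (w%:M : 'M[C]_2)).
  by rewrite dw prim_root_exp_coprime.
have ph : 3.-primitive_root (w%:M : 'M[C]_2).
  apply: prim_root_primes => //; first by rewrite scalar_mx2X (prim_expr_order pw).
  rewrite /= andbT expr1; apply/eqP => w1.
  by have := prim_order_dvd pw 1; rewrite (scalar_mx2_inj w1) eqxx.
have gw : g * w%:M = w%:M * g by rewrite -!mulmxE scalar_mxC.
have Rw : R w by rewrite RE; apply: O_opp3_2pi3.
have Rwm : GL2 R w%:M.
  rewrite scalar_mx2; apply: (GL2_mx2 (u := w)); rewrite //; try exact: subring0.
  by rewrite mulr0 subr0 -(prim_expr_order pw); ring.
have [sP dP iP] := commuting_prods (isT : 1 < 4)%N (isT : 1 < 3)%N pg dg ph pd gw.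
exists (prods g w%:M) => //; split=> //.
  by apply: prods_sub => //; apply: GL2_subgroup.
by split=> //; exists g; split.
Qed.

Lemma HC4_8_intro R g h : R = Zi K -> SL2 R g -> 4.-primitive_root g ->
    GL2 R h -> \det h = 'i%R -> h * g * h^-1 = g^-1 ->
  HC4 8 R (prods g h).
Proof.
move=> RE [Rg dg] pg Rh dh hg; have [g2 _] := SL2_prim4 dg pg.
have sR : is_subring R by rewrite RE; apply: Zi_subring.
have th := inverting_tr0 g2 (GL2_unit Rh) hg.
have h4 : h ^+ 4 = -1.
  by rewrite -[4%N]/(2 * 2)%N exprM (sqr_tr0 th) scalar_mx2X dh sqrrN sqrCi -mxN1.
have pd : 4.-primitive_root (\det h) by rewrite dh; apply: prim_i.
have h4' : h ^+ 4 = g ^+ 2 by rewrite h4 g2.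
have [sP gP _] := inverting_prods pg dg pd h4' hg.
split=> //; first by apply: prods_sub => //; apply: GL2_subgroup.
  split=> //; exists g, h; split=> //; first by split=> //; apply: has_order_prim.
  split=> //.
    have h8 : h ^+ 8 = 1 by rewrite -[8%N]/(4 * 2)%N exprM h4 sqrrN expr1n.
    by have [m pm _] := prim_order_exists (isT : 0 < 8)%N h8; apply: finite_cycle_of pm.
  apply: eigenvalues_mx2.
    have -> : 3 * pi / 4 = - (pi / 4) + pi :> K by field.
    by rewrite expiDpi addNr th.
  by rewrite -expiD dh -expi_pihalf; congr expi; field.
exact: HC4_type8.
Qed.

Lemma HC4_9_intro R g h : R = O_opp K 3 -> SL2 R g -> 4.-primitive_root g ->
    GL2 R h -> \det h = expi (pi / 3) -> h * g * h^-1 = g^-1 ->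
  HC4 9 R (prods g h).
Proof.
move=> RE [Rg dg] pg Rh dh hg; have [g2 _] := SL2_prim4 dg pg.
have sR : is_subring R by rewrite RE; apply: O_opp_subring.
have th := inverting_tr0 g2 (GL2_unit Rh) hg.
have pd : 6.-primitive_root (\det h) by rewrite dh; apply: prim_pi3.
have h6 : h ^+ 6 = 1.
  rewrite -[6%N]/(2 * 3)%N exprM (sqr_tr0 th) scalar_mx2X dh.
  by have := expi_pi3 K; move: (expi _) => z z2; rewrite (_ : _ ^+ 3 = 1) //; ring: z2.
have h6' : h ^+ 6 = g ^+ 4 by rewrite h6 (prim_expr_order pg).
have [sP gP _] := inverting_prods pg dg pd h6' hg.
split=> //; first by apply: prods_sub => //; apply: GL2_subgroup.
  split=> //; exists g, h; split=> //; first by split=> //; apply: has_order_prim.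
  split=> //.
    have [m pm _] := prim_order_exists (isT : 0 < 6)%N h6.
    exact: finite_cycle_of pm.
  apply: eigenvalues_mx2.
    have -> : 2 * pi / 3 = - (pi / 3) + pi :> K by field.
    by rewrite expiDpi addNr th.
  by rewrite -expiD dh; congr expi; field.
exact: HC4_type9.
Qed.

End Groups.

(** * Existence *)

Section Examples.
Variable K : realType.
Local Notation C := K[i].
Implicit Types (R F : set C) (g h x : 'M[C]_2).

Definition quarter_turn : 'M[C]_2 := mx2 0 (-1) 1 0.

Definition diag_i : 'M[C]_2 := mx2 'i%R 0 0 (- 'i%R).

Lemma quarter_turn_SL2 R : is_subring R -> SL2 R quarter_turn.
Proof.
move=> sR; have [R1 _ _] := sR; have R0 := subring0 sR.
split; last by rewrite det_mx2; ring.
apply: (GL2_mx2 (u := 1)) => //; first exact: subringN.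
by ring.
Qed.

Lemma quarter_turn_sqr : quarter_turn ^+ 2 = -1.
Proof. by rewrite expr2 mx2M mxN1 scalar_mx2; congr mx2; ring. Qed.

Lemma diag_i_SL2 R : is_subring R -> R 'i%R -> SL2 R diag_i.
Proof.
move=> sR Ri; have [R1 _ _] := sR; have R0 := subring0 sR.
have E : 'i%R * - 'i%R - 0 * 0 = 1 :> C.
  by rewrite mulrN -expr2 sqrCi; ring.
split; last by rewrite det_mx2.
by apply: (GL2_mx2 (u := 1)) => //; [exact: subringN|rewrite E mulr1].
Qed.

Lemma diag_i_sqr : diag_i ^+ 2 = -1.
Proof.
rewrite expr2 mx2M mxN1 scalar_mx2.
by have := sqrCi C; move: 'i%R => i i2; congr mx2; ring: i2.
Qed.

Lemma Zi_i : Zi K 'i%R.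
Proof. by exists 0, 1; rewrite mul1r add0r. Qed.

Lemma HC4_1_ex : exists H, HC4 1 (O_opp K 2) H.
Proof.
have sO := O_opp_subring K 2; have [O1 _ _] := sO; have O0 := subring0 sO.
exists (cycle_of (mx2 0 1 1 (sqrtN K 2))).
apply: HC4_1_intro => //; rewrite ?det_mx2 ?tr_mx2 ?add0r //; last by ring.
apply: (GL2_mx2 (u := -1)) => //; [exact: O_opp_sqrtN|exact: subringN|by ring].
Qed.

(** The matrix h with trace 0 and determinant w, a primitive cube root of unity,
has h^2 = -w of order 6, hence order 12. *)
Lemma HC4_4_ex : exists H, HC4 4 (O_opp K 3) H.
Proof.
have sO := O_opp_subring K 3; have [O1 _ _] := sO; have O0 := subring0 sO.
have Ow := O_opp3_2pi3 K; have pw := prim_2pi3 K.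
have Ew : expi (5 * pi / 6) * expi (- (pi / 6)) = expi (2 * pi / 3) :> C.
  by rewrite -expiD; congr expi; field.
have w3 := prim_expr_order pw.
set w := expi (2 * pi / 3) in Ow pw Ew w3.
pose h : 'M[C]_2 := mx2 0 (- w) 1 0.
have dh : \det h = w by rewrite det_mx2; ring.
have th : \tr h = 0 by rewrite tr_mx2 addr0.
have h2 := sqr_tr0 th; rewrite dh in h2.
have h6 : h ^+ 6 = -1.
  rewrite -[6%N]/(2 * 3)%N exprM h2 scalar_mx2X mxN1; congr _%:M.
  by rewrite exprNn w3; ring.
have h4 : h ^+ 4 = (w ^+ 2)%:M.
  by rewrite -[4%N]/(2 * 2)%N exprM h2 scalar_mx2X sqrrN.
have ph : 12.-primitive_root h.
  apply: prim_root_primes; first by [].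
    by rewrite -[12%N]/(6 * 2)%N exprM h6 sqrrN expr1n.
  rewrite /= h6 mxN1_neq1 andbT h4.
  apply/eqP => /scalar_mx2_inj/eqP.
  by rewrite -(prim_order_dvd pw).
have Rh : GL2 (O_opp K 3) h.
  apply: (GL2_mx2 (u := w ^+ 2)) => //; [exact: subringN|exact: subringX|].
  by rewrite -[RHS]w3; ring.
exists (cycle_of h); split.
- exact: subgroup_cycle (prim_root_unit ph).
- by apply: cycle_of_sub => //; apply: GL2_subgroup.
- split=> //; exists h => //; split=> //; first exact: finite_cycle_of ph.
  apply: eigenvalues_mx2; last by rewrite Ew.
  have -> : 5 * pi / 6 = - (pi / 6) + pi :> K by field.
  by rewrite expiDpi addNr.
- exact: isom_fin_cycle.
Qed.

Lemma HC4_5_ex : exists H, HC4 5 (O_opp K 3) H.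
Proof.
have [||H H5 _] := @HC4_5_intro K (O_opp K 3) quarter_turn erefl.
- exact/quarter_turn_SL2/O_opp_subring.
- by rewrite tr_mx2 addr0.
by exists H.
Qed.

Lemma HC4_2_ex : exists H, HC4 2 (Zi K) H.
Proof.
have sZ := Zi_subring K; have [Z1 _ _] := sZ; have Z0 := subring0 sZ.
exists (prods diag_i (mx2 (-1) 0 0 1)); apply: HC4_2_intro => //.
- exact: diag_i_SL2 sZ Zi_i.
- exact/prim4_sqrN1/diag_i_sqr.
- by apply: (GL2_mx2 (u := -1)) => //; try exact: subringN; ring.
- by rewrite expr2 mx2M -[RHS]/(1%:M) scalar_mx2; congr mx2; ring.
- by rewrite det_mx2; ring.
- by rewrite !mx2M; congr mx2; ring.
Qed.

(** All diagonal matrices with entries in the group of fourth roots of unity. *)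
Lemma HC4_6_ex : exists H, HC4 6 (Zi K) H.
Proof.
have sZ := Zi_subring K; have [Z1 _ _] := sZ; have Z0 := subring0 sZ.
have [Sg dg] := diag_i_SL2 sZ Zi_i; have pg := prim4_sqrN1 diag_i_sqr.
pose h : 'M[C]_2 := mx2 'i%R 0 0 1.
have dh : \det h = 'i%R by rewrite det_mx2; ring.
have pd : 4.-primitive_root (\det h) by rewrite dh; apply: prim_i.
have gh : diag_i * h = h * diag_i by rewrite !mx2M; congr mx2; ring.
have h2 : h ^+ 2 = mx2 (-1) 0 0 1.
  by rewrite expr2 mx2M; have := sqrCi C; move: 'i%R => i i2; congr mx2; ring: i2.
have ph : 4.-primitive_root h.
  apply: prim_root_primes => //.
    rewrite -[4%N]/(2 * 2)%N exprM h2 expr2 mx2M -[RHS]/(1%:M) scalar_mx2.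
    by congr mx2; ring.
  rewrite /= andbT h2; apply/eqP => E.
  have := congr1 (fun M : 'M_2 => M 0 0) E; rewrite !mxE /= => /eqP.
  by apply/negP/N1_neq1.
have Rh : GL2 (Zi K) h.
  apply: (GL2_mx2 (u := - 'i%R)) => //; try exact: subringN; try exact: Zi_i.
    by apply: subringN => //; apply: Zi_i.
  by have := sqrCi C; move: 'i%R => i i2; ring: i2.
have [sP dP iP] := commuting_prods (isT : 1 < 4)%N (isT : 1 < 4)%N pg dg ph pd gh.
exists (prods diag_i h); split=> //.
  by apply: prods_sub => //; apply: GL2_subgroup.
split=> //; exists diag_i, h; split=> //.
  by split; [split|apply: has_order_prim].
split=> //; first exact: finite_cycle_of ph.
by apply: eigenvalues_mx2; rewrite ?tr_mx2 ?dh ?mulr1 -?complexiE.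
Qed.

Lemma Qsqrt2_i_subfield : is_subfield (Qsqrt2_i K).
Proof. exact: subfield_field_gen. Qed.

Lemma Qsqrt2_i_i : Qsqrt2_i K 'i%R.
Proof. by apply: field_gen_gen; right; rewrite complexiE. Qed.

(** If z is this eighth root of unity, then z + z^3 = z (1 + i) = i sqrt(2). *)
Lemma Qsqrt2_i_pi4 : Qsqrt2_i K (expi (pi / 4)).
Proof.
have [sQ QV] := Qsqrt2_i_subfield; have [Q1 _ _] := sQ; have Qi := Qsqrt2_i_i.
have Q2 : Qsqrt2_i K (Num.sqrt (2%:R : K))%:C by apply: field_gen_gen; left.
have z2 : expi (pi / 4) ^+ 2 = 'i%R :> C.
  by rewrite expiX -expi_pihalf; congr expi; field.
have z3 : expi (3 * pi / 4) = expi (pi / 4) ^+ 3 :> C.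
  by rewrite expiX; congr expi; field.
have E : expi (pi / 4) * (1 + 'i%R) = 'i%R * (Num.sqrt (2%:R : K))%:C.
  transitivity (sqrtN K 2).
    by rewrite -expi_pi4 z3 -z2; move: (expi _) => z; ring.
  by rewrite -complexiE /sqrtN; simpc.
have i1 : 1 + 'i%R != 0 :> C.
  apply/eqP => /(congr1 (fun z => ('i%R - 1) * z)); rewrite mulr0 => /eqP.
  have -> : ('i%R - 1) * (1 + 'i%R) = -2%:R :> C.
    by have := sqrCi C; move: 'i%R => i i2; ring: i2.
  by rewrite oppr_eq0 pnatr_eq0.
have -> : expi (pi / 4) = 'i%R * (Num.sqrt (2%:R : K))%:C * (1 + 'i%R)^-1.
  by rewrite -E mulfK.
apply: (subringM sQ); first exact (subringM sQ Qi Q2).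
by apply: QV; exact (subringD sQ Q1 Qi).
Qed.

(** Only the isomorphism type matters over this larger field: -1 and the diagonal
matrix (1, z), with z a primitive eighth root of unity, generate a direct
product because the determinant of the latter still has order 8. *)
Lemma HC4o_7_ex : exists H, HC4o 7 (Qsqrt2_i K) H.
Proof.
have [sQ _] := Qsqrt2_i_subfield; have [Q1 _ _] := sQ; have Q0 := subring0 sQ.
have pz := prim_pi4 K; have Qz := Qsqrt2_i_pi4; set z := expi _ in pz Qz.
pose h : 'M[C]_2 := mx2 1 0 0 z.
have dh : \det h = z by rewrite det_mx2; ring.
have hX n : h ^+ n = mx2 1 0 0 (z ^+ n).
  elim: n => [|n IHn]; first by rewrite -[LHS]/(1%:M) scalar_mx2.
  by rewrite exprS IHn mx2M exprS; congr mx2; ring.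
have pd : 8.-primitive_root (\det h) by rewrite dh.
have ph : 8.-primitive_root h.
  apply: prim_root_primes => //.
    by rewrite hX (prim_expr_order pz) -[RHS]/(1%:M) scalar_mx2.
  rewrite /= hX andbT; apply/eqP => /(congr1 (fun M : 'M_2 => M 1 1)).
  by rewrite !mxE /= => /eqP; rewrite -(prim_order_dvd pz).
have dN : \det (-1 : 'M[C]_2) = 1 by rewrite mxN1 scalar_mx2 det_mx2; ring.
have pN : 2.-primitive_root (-1 : 'M[C]_2).
  by apply: prim_root_primes; rewrite ?sqrrN ?expr1n //= expr1 mxN1_neq1.
have comm : -1 * h = h * -1 by rewrite mulN1r mulrN1.
have [sP _ iP] := commuting_prods (isT : 1 < 2)%N (isT : 1 < 8)%N pN dN ph pd comm.
exists (prods (-1) h); split=> //; apply: prods_sub; first exact: GL2_subgroup.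
  rewrite mxN1 scalar_mx2; have QN1 := subringN sQ Q1.
  apply: (GL2_mx2 (u := 1)) => //.
  by ring.
apply: (GL2_mx2 (u := z ^+ 7)) => //; first exact (subringX 7 sQ Qz).
by rewrite -[RHS](prim_expr_order pz); ring.
Qed.

Lemma HC4o_8_ex : exists H, HC4o 8 (Qsqrt2_i K) H.
Proof.
have [sQ _] := Qsqrt2_i_subfield; have [Q1 _ _] := sQ; have Q0 := subring0 sQ.
have Qi := Qsqrt2_i_i; have [Sg dg] := diag_i_SL2 sQ Qi.
have g2 := diag_i_sqr.
pose h : 'M[C]_2 := mx2 0 1 (- 'i%R) 0.
have dh : \det h = 'i%R by rewrite det_mx2; ring.
have QNi := subringN sQ Qi.
have Rh : GL2 (Qsqrt2_i K) h.
  apply: (GL2_mx2 (u := - 'i%R)) => //.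
  by have := sqrCi C; move: 'i%R => i i2; ring: i2.
have h4 : h ^+ 4 = -1.
  have th : \tr h = 0 by rewrite tr_mx2 addr0.
  rewrite -[4%N]/(2 * 2)%N exprM (sqr_tr0 th) dh scalar_mx2X.
  by rewrite sqrrN sqrCi -mxN1.
have hg : h * diag_i * h^-1 = diag_i^-1.
  apply: inverting_intro => //; first exact: GL2_unit Rh.
  by rewrite !mx2M mx2N; congr mx2; ring.
have pg := prim4_sqrN1 g2.
have pd : 4.-primitive_root (\det h) by rewrite dh; apply: prim_i.
have h4' : h ^+ 4 = diag_i ^+ 2 by rewrite h4 g2.
have [sP _ _] := inverting_prods pg dg pd h4' hg.
exists (prods diag_i h); split=> //; last exact: HC4_type8.
by apply: prods_sub => //; apply: GL2_subgroup.
Qed.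

Lemma HC4_3_ex R : is_subring R -> exists H, HC4 3 R H.
Proof.
move=> sR; have [R1 _ _] := sR; have R0 := subring0 sR.
have g2 := quarter_turn_sqr; have RN := subringN sR R1.
exists (prods quarter_turn (mx2 1 0 0 (-1))).
have Rh : GL2 R (mx2 1 0 0 (-1)).
  by apply: (GL2_mx2 (u := -1)) => //; ring.
apply: HC4_3_intro => //; [exact: quarter_turn_SL2|exact: prim4_sqrN1|..].
  by rewrite det_mx2; ring.
apply: inverting_intro => //; first exact: GL2_unit Rh.
by rewrite !mx2M mx2N; congr mx2; ring.
Qed.

Lemma HC4o_9_ex : exists H, HC4o 9 (Qsqrt_opp K 3) H.
Proof.
have [sQ _] := Qsqrt_opp_subfield K 3; have [Q1 _ _] := sQ.
have Q0 := subring0 sQ; have g2 := quarter_turn_sqr.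
have [Qw _] := O_opp3_2pi3 K; have [Sg dg] := quarter_turn_SL2 sQ.
have z2 := expi_pi3 K; have wz := expi_2pi3 K; have pz := prim_pi3 K.
set w := expi (2 * pi / 3) in Qw wz; set z := expi (pi / 3) in z2 wz pz.
pose h : 'M[C]_2 := mx2 w 0 0 (- w); have QNw := subringN sQ Qw.
have dh : \det h = z by rewrite det_mx2 wz; ring: z2.
have Rh : GL2 (Qsqrt_opp K 3) h.
  apply: (GL2_mx2 (u := - w)) => //.
  by rewrite wz; ring: z2.
have h6 : h ^+ 6 = 1.
  have th : \tr h = 0 by rewrite tr_mx2 subrr.
  rewrite -[6%N]/(2 * 3)%N exprM (sqr_tr0 th) dh scalar_mx2X.
  by rewrite (_ : _ ^+ 3 = 1) //; ring: z2.
have hg : h * quarter_turn * h^-1 = quarter_turn^-1.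
  apply: inverting_intro => //; first exact: GL2_unit Rh.
  by rewrite !mx2M mx2N; congr mx2; ring.
have pg := prim4_sqrN1 g2; rewrite -dh in pz.
have h6' : h ^+ 6 = quarter_turn ^+ 4 by rewrite h6 (prim_expr_order pg).
have [sP _ _] := inverting_prods pg dg pz h6' hg.
exists (prods quarter_turn h); split; first exact: sP.
  exact (prods_sub (GL2_subgroup sQ) Sg Rh).
exact: HC4_type9 g2 dg pz h6 hg.
Qed.

End Examples.

(** * Classification *)

Section Classification.
Variable K : realType.
Local Notation C := K[i].
Variables (R : set C) (H : set 'M[C]_2) (g : 'M[C]_2).
Hypothesis ellR : is_elliptic_End R.
Hypothesis sH : is_subgroup H.
Hypothesis HR : H `<=` GL2 R.
Hypothesis HS : H `&` SL2 R = cycle_of g.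
Hypothesis pg : 4.-primitive_root g.
Implicit Types h x : 'M[C]_2.

Definition listed := exists (i : nat) (H' : set 'M[C]_2),
  [/\ (1 <= i <= 9)%N, HC4 i R H' & isom_sub H H'].

Let sR : is_subring R. Proof. exact: elliptic_subring ellR. Qed.

Let Hg : H g.
Proof. by have := cycle_of_id g; rewrite -HS => -[]. Qed.

Let Sg : SL2 R g.
Proof. by have := cycle_of_id g; rewrite -HS => -[]. Qed.

Let dg : \det g = 1. Proof. by case: Sg. Qed.
Let g2 : g ^+ 2 = -1. Proof. by have [] := SL2_prim4 dg pg. Qed.
Let tg : \tr g = 0. Proof. by have [] := SL2_prim4 dg pg. Qed.
Let gU : g \is a GRing.unit. Proof. exact: prim_root_unit pg. Qed.
Let gV : g^-1 = - g.
Proof. by apply: (mulIr gU); rewrite mulVr // mulNr -expr2 g2 opprK. Qed.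

Lemma det1_cycle x : H x -> \det x = 1 -> cycle_of g x.
Proof. by move=> Hx dx; rewrite -HS; split=> //; split=> //; apply: HR. Qed.

Lemma cycle4 x : cycle_of g x -> [\/ x = 1, x = -1, x = g | x = - g].
Proof.
rewrite (cycle_ofE pg) => -[k k4 ->].
case: k k4 => [|[|[|[|//]]]] _;
  [constructor 1|constructor 3|constructor 2|constructor 4] => //.
by rewrite exprS g2 mulrN1.
Qed.

(** H is the union of the cosets of its subgroup of determinant 1 by the powers of
any element whose determinant generates det(H). This allows another element
with this property to be used in place of the given one. *)
Lemma prodsE s h : H h -> s.-primitive_root (\det h) ->
  [set \det x | x in H] = cycle_of (\det h) -> H = prods g h.
Proof.
move=> Hh ph Hd; apply/seteqP; split; last exact: prods_sub.
move=> x Hx; have hU := subgroup_unit sH Hh.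
have : [set \det x | x in H] (\det x) by exists x.
rewrite Hd (cycle_ofE ph) => -[b _ db].
have Hb := subgroupX b sH Hh.
have : cycle_of g (x * (h ^+ b)^-1).
  apply: det1_cycle; first by apply: subgroupM => //; apply: subgroupV.
  by rewrite detM detV ?unitrX // detX db mulfV // -detX; apply: GL2_det_neq0 (HR Hb).
rewrite (cycle_ofE pg) => -[a _ E]; exists a, b.
by rewrite -E divrK ?unitrX.
Qed.

(** Conjugation by h permutes the two generators of the cyclic normal
subgroup of order 4. *)
Lemma conj_dichotomy h : H h -> g * h = h * g \/ h * g * h^-1 = g^-1.
Proof.
move=> Hh; have hU := subgroup_unit sH Hh.
have : cycle_of g (h * g * h^-1).
  apply: det1_cycle.
    by apply: subgroupM => //; [apply: subgroupM|apply: subgroupV].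
  by rewrite !detM detV // dg mulr1 mulfV //; apply: GL2_det_neq0 (HR Hh).
have N1 : (-1 : 'M[C]_2) <> 1 by apply/eqP/mxN1_neq1.
have gc (c : 'M[C]_2) : h * g * h^-1 = c -> c * h = h * c -> g = c.
  move=> E ch; apply: (mulrI hU); rewrite -ch -E.
  by rewrite divrK.
case/cycle4=> E.
- by case: N1; rewrite -g2 (gc _ E) ?expr1n // mul1r mulr1.
- by case: N1; rewrite -g2 (gc _ E) ?sqrrN ?expr1n // mulN1r mulrN1.
- by left; rewrite -{1}E divrK.
- by right; rewrite gV.
Qed.

Lemma scalar_entry h (a : C) : GL2 R h -> h = a%:M -> R a.
Proof. by move=> [Rh _] ha; have := Rh 0 0; rewrite ha mxE. Qed.

Lemma sqrtN1_in (a : C) : R a -> a ^+ 2 = -1 -> R 'i%R.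
Proof.
move=> Ra /eqP; rewrite -(sqrCi C) eqf_sqr => /orP[]/eqP aE; first by rewrite -aE.
by have := subringN sR Ra; rewrite aE opprK.
Qed.

(** The trace of h cannot be 0, as then h^2 would be 1; so h is the scalar i or -i. *)
Lemma sqrN1_detN1 h : GL2 R h -> h ^+ 2 = -1 -> \det h = -1 -> R 'i%R.
Proof.
move=> Rh h2 dh; have h2' := h2; rewrite mxN1 in h2'.
case: (scalar_or_tr0 h2') => [/sqr_tr0|[a ha]].
  rewrite h2' dh opprK => /scalar_mx2_inj/eqP.
  by rewrite (negPf (N1_neq1 K)).
apply: (sqrtN1_in (scalar_entry Rh ha)).
by apply: scalar_mx2_inj; rewrite -scalar_mx2X -ha.
Qed.

(** An element k of determinant -1 that commutes with g and squares into the group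
generated by g exists for special rings only. If k^2 = 1 then gk has square
-1 and determinant -1; if k^2 = -1 this holds for k; by sqrN1_detN1 the ring
contains i. If k^2 = g or -g, then tr(k)^2 = tr(k^2) + 2 det(k) = -2, so the
ring contains a square root of -2. *)
Lemma commuting_sqr k : GL2 R k -> \det k = -1 -> g * k = k * g ->
  cycle_of g (k ^+ 2) ->
  (k ^+ 2 = 1 \/ k ^+ 2 = -1) /\ R 'i%R \/
  (k ^+ 2 = g \/ k ^+ 2 = - g) /\ \tr k ^+ 2 = - 2%:R.
Proof.
move=> Rk dk gk; have trk : \tr (k ^+ 2) = 0 -> \tr k ^+ 2 = - 2%:R.
  by rewrite tr_sqr dk => E; rewrite -[LHS]subr0 -E; ring.
case/cycle4=> E.
- left; split; first by left.
  apply: (@sqrN1_detN1 (g * k)); last by rewrite detM dg mul1r.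
    exact (subgroupM (GL2_subgroup sR) Sg.1 Rk).
  by rewrite exprMn_comm // g2 E mulr1.
- by left; split; [right|apply: sqrN1_detN1 Rk E dk].
- by right; split; [left|apply: trk; rewrite E].
- by right; split; [right|apply: trk; rewrite E raddfN /= tg oppr0].
Qed.

(** If the trace of h is 0 this is the Cayley-Hamilton theorem. Otherwise h is a
scalar, a primitive eighth root of unity, which R cannot contain by
elliptic_root_of_unity. *)
Lemma sqr_scalar_i h (a : C) : GL2 R h -> h ^+ 2 = a%:M -> a ^+ 2 = -1 ->
  \det h = - a.
Proof.
move=> Rh h2 a2; case: (scalar_or_tr0 h2) => [/sqr_tr0|[b hb]].
  by rewrite h2 => /scalar_mx2_inj ->; rewrite opprK.
have b2 : b ^+ 2 = a by apply: scalar_mx2_inj; rewrite -scalar_mx2X -hb.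
have b4 : b ^+ 4 = -1 by rewrite -[4%N]/(2 * 2)%N exprM b2.
have b8 : b ^+ 8 = 1 by rewrite -[8%N]/(4 * 2)%N exprM b4 sqrrN expr1n.
have N1 := N1_neq1 K.
have [] := elliptic_root_of_unity ellR (isT : 0 < 8)%N (scalar_entry Rh hb) b8.
  by rewrite b4 => /eqP; rewrite (negPf N1).
rewrite -[6%N]/(2 * 3)%N exprM b2 exprS a2 mulrN1 => /(congr1 (fun z => z ^+ 2)).
by rewrite sqrrN a2 expr1n => /eqP; rewrite (negPf N1).
Qed.

Lemma listed_self i : (1 <= i <= 9)%N -> HC4 i R H -> listed.
Proof. by move=> i9 Hi; exists i, H; split=> //; apply: isom_sub_refl. Qed.

Lemma listed_isom (gT : finGroupType) (G : {group gT}) i H' :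
    (1 <= i <= 9)%N -> HC4 i R H' -> isom_fin G H -> isom_fin G H' -> listed.
Proof. by move=> i9 Hi iH iH'; exists i, H'; split=> //; apply: isom_fin_sub iH iH'. Qed.

Lemma no_sqrt_pair a b (p q : nat) : R a -> R b ->
  a ^+ 2 = - p%:R -> b ^+ 2 = - q%:R ->
  (forall m : int, m ^+ 2 <> (p * q)%N) -> False.
Proof.
by move=> Ra Rb a2 b2 pq; have [m] := elliptic_sqr_mul ellR Ra Rb a2 b2; apply: pq.
Qed.

Section DetOrder.
Variables (s : nat) (h : 'M[C]_2).
Hypothesis Hh : H h.
Hypothesis pd : s.-primitive_root (\det h).
Hypothesis Hd : [set \det x | x in H] = cycle_of (\det h).

Let Rh : GL2 R h. Proof. exact: HR. Qed.
Let hU : h \is a GRing.unit. Proof. exact: subgroup_unit sH Hh. Qed.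
Let Rd : R (\det h). Proof. exact: GL2_det. Qed.

Let hs : cycle_of g (h ^+ s).
Proof.
apply: det1_cycle; first exact: subgroupX.
by rewrite detX (prim_expr_order pd).
Qed.

(** The determinant of h is a root of unity in R. *)
Lemma det_order : (1 < s)%N -> [\/ s = 2, s = 3, s = 4 | s = 6].
Proof.
move=> s1; have s0 := prim_order_gt0 pd.
have [] := elliptic_root_of_unity ellR s0 Rd (prim_expr_order pd);
  move/eqP; rewrite -(prim_order_dvd pd) dvdn_divisors // !inE.
  by case/or3P=> /eqP sE; [move: s1; rewrite sE|constructor 1|constructor 3].
by case/or4P=> /eqP sE; [move: s1; rewrite sE|constructor 1|constructor 2|constructor 4].
Qed.

(** The determinant of h has order s and h^s = 1, so h has order exactly s and
its nontrivial powers lie outside the group generated by g. *)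
Lemma commuting_split : (1 < s)%N -> g * h = h * g -> h ^+ s = 1 ->
  isom_fin (finset.setX (Zp 4) (Zp s)) H.
Proof.
move=> s1 gh hs1; have [m pm ms] := prim_order_exists (prim_order_gt0 pd) hs1.
have sm : (s %| m)%N.
  by rewrite (prim_order_dvd pd) -detX (prim_expr_order pm) det1.
have ms' : m = s by apply/eqP; rewrite eqn_dvd ms sm.
rewrite ms' in pm; rewrite (prodsE Hh pd Hd).
by have [] := commuting_prods (isT : 1 < 4)%N s1 pg dg pm pd gh.
Qed.

End DetOrder.

(** If h^2 = 1 or -1, then R = Z[i] and h or gh is an involution that splits off.
If h^2 = g or -g, then R contains sqrt(-2) and H is cyclic of order 8; the
sign of h is chosen to match the prescribed eigenvalues. *)
Lemma commuting2 h : H h -> \det h = -1 ->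
  [set \det x | x in H] = cycle_of (\det h) -> g * h = h * g -> listed.
Proof.
move=> Hh dh Hd gh; have Rh := HR Hh.
have p1 : 2.-primitive_root (\det h) by rewrite dh; apply: prim_N1.
have hs : cycle_of g (h ^+ 2).
  by apply: det1_cycle; [apply: subgroupX|rewrite detX dh sqrrN expr1n].
have two k : H k -> \det k = \det h -> g * k = k * g -> k ^+ 2 = 1 -> R 'i%R ->
    listed.
  move=> Hk dk gk k2 Ri; rewrite -dk in p1 Hd.
  apply: (@listed_self 2) => //; rewrite (prodsE Hk p1 Hd).
  apply: HC4_2_intro => //; first exact: elliptic_Zi ellR Ri.
    exact: HR.
  by rewrite dk.
case: (commuting_sqr Rh dh gh hs) => -[h2 Ri].
  case: h2 => h2; first exact: (two h).
  apply: (two (g * h)) => //; first exact: subgroupM.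
  - by rewrite detM dg mul1r.
  - by rewrite gh mulrA gh.
  - by rewrite exprMn_comm // g2 h2 mulrN1 opprK.
have one k : H k -> H = prods g k -> \det k = -1 -> k ^+ 2 = g \/ k ^+ 2 = - g ->
    \tr k = sqrtN K 2 -> listed.
  move=> Hk HE dk k2 tk; have Rk := HR Hk; have kU := subgroup_unit sH Hk.
  have Rt := GL2_tr sR Rk; rewrite tk in Rt.
  apply: (@listed_self 1) => //.
  suff -> : H = cycle_of k by apply: HC4_1_intro => //; apply: elliptic_O_opp2.
  apply/seteqP; split; last exact: cycle_of_sub.
  have sk := subgroup_cycle kU; rewrite HE; apply: prods_sub => //; last exact: cycle_of_id.
  case: k2 => k2; first by rewrite -k2; apply: cycle_ofX.
  have -> : g = (k ^+ 2)^-1 by rewrite k2 -gV invrK.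
  exact (subgroupV sk (cycle_ofX 2 kU)).
have HE := prodsE Hh p1 Hd.
case: (sqrtN_uniq Ri) => th; first exact: (one h).
have Nh : - h = g ^+ 2 * h by rewrite g2 mulN1r.
have HN : H (- h) by rewrite Nh; apply: subgroupM => //; apply: subgroupX.
apply: (one (- h)); first exact: HN.
- have dN : \det (- h) = \det h by rewrite Nh detM detX dg expr1n mul1r.
  by rewrite -dN in p1 Hd; apply: prodsE p1 Hd.
- by rewrite Nh detM detX dg expr1n mul1r.
- by rewrite sqrrN.
- by rewrite raddfN /= th opprK.
Qed.

(** The primitive cube roots of unity are w = exp(2 i pi / 3) and -1 - w, so R
contains w, and exp(i pi / 3) = w + 1. *)
Lemma prim3_O3 (e : C) : R e -> 3.-primitive_root e -> R (expi (pi / 3)).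
Proof.
move=> Re pe; set w := expi (2 * pi / 3) : C.
have wz : expi (pi / 3) = w + 1 by rewrite /w expi_2pi3; ring.
rewrite wz; apply: (subringD sR) => //; last by case: sR.
have w2 : w ^+ 2 = - w - 1.
  have := expi_pi3 K; rewrite wz; clearbody w => z2.
  by transitivity ((w + 1) ^+ 2 - 2 * w - 1); [ring|rewrite z2; ring].
have e2 : e ^+ 2 + e + 1 = 0.
  have e1 : e - 1 != 0.
    by rewrite subr_eq0 -[e]expr1 -(prim_order_dvd pe).
  apply: (mulfI e1); rewrite mulr0.
  by have := prim_expr_order pe; move: (e) => z z3; ring: z3.
have : (e - w) * (e + w + 1) = 0.
  by rewrite -e2; clearbody w; ring: w2.
move/eqP; rewrite mulf_eq0 => /orP[/eqP/subr0_eq <- //|/eqP E].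
have -> : w = - e - 1 by rewrite -[LHS]subr0 -E; ring.
case: (sR) => R1 RB _; apply: RB => //; exact: subringN.
Qed.

(** If h^3 = g^k, then g^k h has the same determinant as h and its cube is
g^(4k) = 1, so a complement of order 3 exists. *)
Lemma commuting3 h : H h -> 3.-primitive_root (\det h) ->
  [set \det x | x in H] = cycle_of (\det h) -> g * h = h * g -> listed.
Proof.
move=> Hh pd Hd gh; have Rh := HR Hh.
have : cycle_of g (h ^+ 3).
  by apply: det1_cycle; [apply: subgroupX|rewrite detX (prim_expr_order pd)].
rewrite (cycle_ofE pg) => -[k _ h3].
have gkh : GRing.comm (g ^+ k) h by apply/commr_sym/commrX.
have Hk : H (g ^+ k * h) by apply: subgroupM => //; apply: subgroupX.
have dk : \det (g ^+ k * h) = \det h by rewrite detM detX dg expr1n mul1r.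
have iH : isom_fin (finset.setX (Zp 4) (Zp 3)) H.
  rewrite -dk in pd Hd; apply: (commuting_split Hk pd Hd isT).
    by rewrite mulrA -exprS exprSr -!mulrA gh.
  by rewrite exprMn_comm // h3 -exprM -exprD -mulnSr mulnC exprM (prim_expr_order pg) expr1n.
have RE : R = O_opp K 3.
  apply: elliptic_O_opp3 => //; rewrite -expi_pi3E.
  by apply: prim3_O3 pd; apply: GL2_det.
have [H' H5 _] := HC4_5_intro RE Sg tg.
by apply: (listed_isom _ H5 iH) => //; case: H5.
Qed.

(** The determinant of h being i or -i, R = Z[i] contains no square root of -2,
which by commuting_sqr applied to h^2 leaves h^4 = 1 or -1. In the second
case h^2 is a scalar c with c^2 = -1, and sqr_scalar_i applied to h and to gh
gives det(h) = -c and det(h) = c, which is absurd. So h^4 = 1. *)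
Lemma commuting4 h : H h -> 4.-primitive_root (\det h) ->
  [set \det x | x in H] = cycle_of (\det h) -> g * h = h * g -> listed.
Proof.
move=> Hh pd Hd gh; have Rh := HR Hh.
have d2 : \det h ^+ 2 = -1.
  have /eqP : (\det h ^+ 2) ^+ 2 = 1 by rewrite -exprM (prim_expr_order pd).
  by rewrite sqrf_eq1 -(prim_order_dvd pd) => /eqP.
have Ri := sqrtN1_in (GL2_det sR Rh) d2; have RE := elliptic_Zi ellR Ri.
have Rh2 : GL2 R (h ^+ 2) by apply: HR; apply: subgroupX.
have gh2 : g * h ^+ 2 = h ^+ 2 * g by apply/commrX.
have dh2 : \det (h ^+ 2) = -1 by rewrite detX.
have hs : cycle_of g ((h ^+ 2) ^+ 2).
  rewrite -exprM; apply: det1_cycle; first exact: subgroupX.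
  by rewrite detX (prim_expr_order pd).
have N1 := N1_neq1 K.
case: (commuting_sqr Rh2 dh2 gh2 hs) => -[h4 E]; last first.
  exfalso; apply: (@no_sqrt_pair 'i%R (\tr (h ^+ 2)) 1 2) => //.
  - exact: GL2_tr.
  - by rewrite sqrCi.
  - by move=> m; apply: (@int_sqr_neq 1).
case: h4 => h4.
  rewrite -exprM in h4.
  have iH := commuting_split Hh pd Hd isT gh h4.
  have [H' H6] := HC4_6_ex K; rewrite -RE in H6.
  by apply: (listed_isom _ H6 iH) => //; case: H6.
exfalso; rewrite mxN1 in h4.
have [t0|[c hc]] := scalar_or_tr0 h4.
  move: (sqr_tr0 t0); rewrite h4 dh2 opprK => /scalar_mx2_inj/eqP.
  by rewrite (negPf N1).
have c2 : c ^+ 2 = -1 by apply: scalar_mx2_inj; rewrite -scalar_mx2X -hc.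
have dc := sqr_scalar_i Rh hc c2.
have Rgh : GL2 R (g * h) by apply: HR; apply: subgroupM.
have gh2' : (g * h) ^+ 2 = (- c)%:M.
  by rewrite (exprMn_comm _ (gh : GRing.comm g h)) g2 hc mulN1r scalar_mx2N.
have := sqr_scalar_i Rgh gh2'; rewrite sqrrN detM dg mul1r dc opprK => /(_ c2)/eqP.
rewrite eq_sym -subr_eq0 opprK -mulr2n mulrn_eq0 /= => /eqP c0.
by move/eqP: c2; rewrite c0 expr0n /= eq_sym oppr_eq0 oner_eq0.
Qed.

Lemma prim6_O3 (e : C) : R e -> 6.-primitive_root e -> R (expi (pi / 3)).
Proof.
move=> Re pe; apply: (@prim3_O3 (e ^+ 2)); first exact: subringX.
exact: (dvdn_prim_root pe (isT : 3 %| 6)%N).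
Qed.

(** Applied to h^3, whose determinant is -1, commuting_sqr puts i or a square
root of -2 in R. But R contains a primitive sixth root of unity z, hence the
square root 2z - 1 of -3, and neither 3 nor 6 is a square. *)
Lemma commuting6 h : H h -> 6.-primitive_root (\det h) -> g * h = h * g -> False.
Proof.
move=> Hh pd gh; have Rh := HR Hh.
have d3 : \det h ^+ 3 = -1.
  have /eqP : (\det h ^+ 3) ^+ 2 = 1 by rewrite -exprM (prim_expr_order pd).
  by rewrite sqrf_eq1 -(prim_order_dvd pd) => /eqP.
have Rh3 : GL2 R (h ^+ 3) by apply: HR; apply: subgroupX.
have gh3 : g * h ^+ 3 = h ^+ 3 * g by apply/commrX.
have hs : cycle_of g ((h ^+ 3) ^+ 2).
  rewrite -exprM; apply: det1_cycle; first exact: subgroupX.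
  by rewrite detX (prim_expr_order pd).
have dh3 : \det (h ^+ 3) = -1 by rewrite detX.
have Rz := prim6_O3 (GL2_det sR Rh) pd.
have Rs : R (expi (pi / 3) + expi (pi / 3) - 1).
  by case: (sR) => R1 RB _; apply: RB => //; apply: subringD.
have s2 : (expi (pi / 3) + expi (pi / 3) - 1) ^+ 2 = - 3%:R :> C.
  by have := expi_pi3 K; move: (expi _) => z z2; ring: z2.
case: (commuting_sqr Rh3 dh3 gh3 hs) => -[_ E].
  apply: (@no_sqrt_pair 'i%R _ 1 3 E Rs) => //; first by rewrite sqrCi.
  by move=> m; apply: (@int_sqr_neq 1).
apply: (@no_sqrt_pair _ _ 2 3 (GL2_tr sR Rh3) Rs) => //.
by move=> m; apply: (@int_sqr_neq 2).
Qed.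

Lemma inverting2 h : H h -> \det h = -1 ->
  [set \det x | x in H] = cycle_of (\det h) -> h * g * h^-1 = g^-1 -> listed.
Proof.
move=> Hh dh Hd hg; have Rh := HR Hh.
have pd : 2.-primitive_root (\det h) by rewrite dh; apply: prim_N1.
apply: (@listed_self 3) => //; rewrite (prodsE Hh pd Hd).
exact: HC4_3_intro.
Qed.

(** The square of h is a scalar and h^3 is a power of g, so both commute with g;
then h itself would commute with g. *)
Lemma inverting3 h : H h -> 3.-primitive_root (\det h) ->
  h * g * h^-1 = g^-1 -> False.
Proof.
move=> Hh pd hg; have Rh := HR Hh; have hU := subgroup_unit sH Hh.
have h2 := sqr_tr0 (inverting_tr0 g2 hU hg).
have : cycle_of g (h ^+ 3).
  by apply: det1_cycle; [apply: subgroupX|rewrite detX (prim_expr_order pd)].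
rewrite (cycle_ofE pg) => -[k _ h3].
have gh3 : g * h ^+ 3 = h ^+ 3 * g by rewrite h3 -exprS exprSr.
have gh2 : g * h ^+ 2 = h ^+ 2 * g by rewrite h2 -!mulmxE scalar_mxC.
have gh : g * h = h * g.
  apply: (mulrI (unitrX 2 hU)).
  by rewrite mulrA -gh2 -mulrA -exprSr gh3 exprSr mulrA.
have : g = g^-1 by rewrite -hg -gh mulrK.
move/(congr1 (fun x => g * x)); rewrite mulrV // -expr2 g2.
by apply/eqP/mxN1_neq1.
Qed.

Lemma inverting_inv h : h \is a GRing.unit -> h * g * h^-1 = g^-1 ->
  h^-1 * g * h^-1^-1 = g^-1.
Proof.
move=> hU hg; rewrite invrK; apply: (mulrI hU).
have hg' : h * g = - (g * h) by rewrite -mulNr -gV -hg divrK.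
by rewrite !mulrA mulrV // mul1r gV mulrN hg' opprK.
Qed.

(** R = Z[i] because it contains the determinant of h, which is i or -i; in the
second case h^-1 is used in place of h. *)
Lemma inverting4 h : H h -> 4.-primitive_root (\det h) ->
  [set \det x | x in H] = cycle_of (\det h) -> h * g * h^-1 = g^-1 -> listed.
Proof.
move=> Hh pd Hd hg; have hU := subgroup_unit sH Hh; have Rh := HR Hh.
have d2 : \det h ^+ 2 = -1.
  have /eqP : (\det h ^+ 2) ^+ 2 = 1 by rewrite -exprM (prim_expr_order pd).
  by rewrite sqrf_eq1 -(prim_order_dvd pd) => /eqP.
have RE := elliptic_Zi ellR (sqrtN1_in (GL2_det sR Rh) d2).
have eight k : H k -> [set \det x | x in H] = cycle_of (\det k) ->
    \det k = 'i%R -> k * g * k^-1 = g^-1 -> listed.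
  move=> Hk Hdk dk kg; have pk : 4.-primitive_root (\det k).
    by rewrite dk; apply: prim_i.
  apply: (@listed_self 8) => //; rewrite (prodsE Hk pk Hdk).
  by apply: HC4_8_intro => //; apply: HR.
move/eqP: d2; rewrite -(sqrCi C) eqf_sqr => /orP[]/eqP dh; first exact: (eight h).
have dV : \det h^-1 = (\det h)^-1 by apply: detV.
apply: (eight h^-1); [exact: subgroupV|..|exact: inverting_inv].
  by rewrite dV (cycle_of_inv pd).
have i0 : 'i%R != 0 :> C by rewrite (prim_root_eq0 (prim_i K)).
rewrite dV dh; apply: (mulIf (_ : - 'i%R != 0)); rewrite ?oppr_eq0 //.
by rewrite mulVf ?oppr_eq0 // mulrN -expr2 sqrCi opprK.
Qed.

(** The determinant of h is exp(i pi / 3) or its inverse; in the second case h^-1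
is used in place of h. *)
Lemma inverting6 h : H h -> 6.-primitive_root (\det h) ->
  [set \det x | x in H] = cycle_of (\det h) -> h * g * h^-1 = g^-1 -> listed.
Proof.
move=> Hh pd Hd hg; have hU := subgroup_unit sH Hh; have Rh := HR Hh.
have RE : R = O_opp K 3.
  apply: elliptic_O_opp3 => //; rewrite -expi_pi3E.
  by apply: prim6_O3 pd; apply: GL2_det.
have nine k : H k -> [set \det x | x in H] = cycle_of (\det k) ->
    \det k = expi (pi / 3) -> k * g * k^-1 = g^-1 -> listed.
  move=> Hk Hdk dk kg; have pk : 6.-primitive_root (\det k).
    by rewrite dk; apply: prim_pi3.
  apply: (@listed_self 9) => //; rewrite (prodsE Hk pk Hdk).
  by apply: HC4_9_intro => //; apply: HR.
have e2 : \det h ^+ 2 - \det h + 1 = 0.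
  have e3 : \det h ^+ 3 = -1.
    have /eqP : (\det h ^+ 3) ^+ 2 = 1 by rewrite -exprM (prim_expr_order pd).
    by rewrite sqrf_eq1 -(prim_order_dvd pd) => /eqP.
  have e1 : \det h + 1 != 0.
    apply/eqP => /eqP; rewrite addr_eq0 => /eqP eN.
    have : \det h ^+ 2 == 1 by rewrite eN sqrrN expr1n.
    by rewrite -(prim_order_dvd pd).
  apply: (mulfI e1); rewrite mulr0.
  by move: (\det h) e3 => e e3; ring: e3.
have z2 := expi_pi3 K; have z0 := expi_neq0 (pi / 3 : K).
have : (\det h - expi (pi / 3)) * (\det h + expi (pi / 3) - 1) = 0.
  by rewrite -e2; move: (expi _) (\det h) z2 => z e z2; ring: z2.
move/eqP; rewrite mulf_eq0 => /orP[/eqP/subr0_eq dh|/eqP E]; first exact: (nine h).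
have dV : \det h^-1 = (\det h)^-1 by apply: detV.
apply: (nine h^-1); [exact: subgroupV|..|exact: inverting_inv].
  by rewrite dV (cycle_of_inv pd).
have dh0 : \det h != 0 by apply: GL2_det_neq0 Rh.
rewrite dV; apply: (mulIf dh0); rewrite mulVf //.
have -> : \det h = 1 - expi (pi / 3) by rewrite -[LHS]subr0 -E; ring.
by move: (expi _) z2 => z z2; ring: z2.
Qed.

Lemma classification s h : H h -> s.-primitive_root (\det h) -> (1 < s)%N ->
  [set \det x | x in H] = cycle_of (\det h) -> listed.
Proof.
move=> Hh pd s1 Hd.
have dN1 : s = 2%N -> \det h = -1.
  move=> s2; rewrite s2 in pd; have /eqP := prim_expr_order pd.
  rewrite sqrf_eq1 => /orP[]/eqP // d1.
  by have := prim_order_dvd pd 1; rewrite d1 expr1n eqxx.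
case: (conj_dichotomy Hh) => hg; case: (det_order Hh pd s1) => sE; rewrite sE in pd.
- exact: commuting2 Hh (dN1 sE) Hd hg.
- exact: commuting3 Hh pd Hd hg.
- exact: commuting4 Hh pd Hd hg.
- by case: (commuting6 Hh pd hg).
- exact: inverting2 Hh (dN1 sE) Hd hg.
- by case: (inverting3 Hh pd hg).
- exact: inverting4 Hh pd Hd hg.
- exact: inverting6 Hh pd Hd hg.
Qed.

End Classification.

Theorem corollary36 (K : realType) :
  (forall (R : set K[i]) (H : set 'M[K[i]]_2) (g ho : 'M[K[i]]_2)
      (r s : nat) (l1 l2 : K[i]),
    is_elliptic_End R ->
    finite_set H -> is_subgroup H -> H `<=` GL2 R ->
    H `&` SL2 R = cycle_of g -> isom_fin (Zp 4) (H `&` SL2 R) ->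
    H ho -> has_order ho r ->
    [set \det x | x in H] = cycle_of (\det ho) ->
    isom_fin (Zp s) [set \det x | x in H] -> (1 < s)%N ->
    eigenvalues ho l1 l2 ->
    exists (i : nat) (H' : set 'M[K[i]]_2),
      [/\ (1 <= i <= 9)%N, HC4 i R H' & isom_sub H H'])
  /\ ((exists H, HC4 1 (O_opp K 2) H)
      /\ (exists H, HC4 4 (O_opp K 3) H)
      /\ (exists H, HC4 5 (O_opp K 3) H)
      /\ (forall g : 'M[K[i]]_2, SL2 (O_opp K 3) g -> \tr g = 0 ->
            exists2 H, HC4 5 (O_opp K 3) H & HC4_5_of g H)
      /\ (exists H, HC4 2 (Zi K) H)
      /\ (exists H, HC4 6 (Zi K) H))
  /\ ((exists H, HC4o 7 (Qsqrt2_i K) H)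
      /\ (exists H, HC4o 8 (Qsqrt2_i K) H)
      /\ (forall d : nat, (0 < d)%N -> exists H, HC4o 3 (Qsqrt_opp K d) H)
      /\ (exists H, HC4o 9 (Qsqrt_opp K 3) H)).
Proof.
split; last first.
  split; [split; [exact: HC4_1_ex|]|].
    split; [exact: HC4_4_ex|split; [exact: HC4_5_ex|]].
    split; [by move=> g; apply: HC4_5_intro|].
    by split; [apply: HC4_2_ex|apply: HC4_6_ex].
  split; [exact: HC4o_7_ex|split; [exact: HC4o_8_ex|]].
  split; [|exact: HC4o_9_ex] => d _.
  have [sQ _] := Qsqrt_opp_subfield K d.
  by have [H [sH HR _ tH]] := HC4_3_ex sQ; exists H.
move=> R H g ho r s l1 l2 ellR _ sH HR HS isoS Hho _ Hd isod s1 _.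
have Rho := HR _ Hho.
have sS : is_subgroup (cycle_of g).
  apply: subgroup_cycle; have : (H `&` SL2 R) g by rewrite HS; apply: cycle_of_id.
  by case=> /(subgroup_unit sH).
have pg : 4.-primitive_root g by apply: isom_fin_prim_root; rewrite // -HS.
have pd : s.-primitive_root (\det ho).
  apply: isom_fin_prim_root; rewrite // -?Hd //.
  by rewrite Hd; apply: subgroup_cycle; rewrite unitfE; apply: GL2_det_neq0 Rho.
exact: (classification ellR sH HR HS pg Hho pd s1 Hd).
Qed.
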